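(* Let $X$ be a Noetherian $\mathbb{F}_1$-scheme and $r\ge 1$. For each $p\in X$ write $\mathcal{O}_{X,p}^{\times}=\mathbb{Z}^{n(p)}\times\Gamma_p$ with $\Gamma_p$ a finite abelian group, and let $l(p)=\operatorname{lcm}\{\operatorname{ord}(g)\mid g\in\Gamma_p\}$. Then the deformed multivariable zeta function of Igusa type $$\zeta^{I}(s_1,\ldots,s_r;w;X)=\sum_{p\in X}\ \sum_{m_1,\ldots,m_r\ge 1}\bigl|\operatorname{Hom}(\mathcal{O}_{X,p}^{\times},\mathbb{Z}/m_1\cdots m_r\mathbb{Z})\bigr|^{w}\,m_1^{-s_1}\cdots m_r^{-s_r}$$ satisfies $$\zeta^{I}(s_1,\ldots,s_r;w;X)=\sum_{p\in X}\ \sum_{k_1,\ldots,k_r=1}^{l(p)}\bigl|\operatorname{Hom}(\Gamma_p,\mathbb{Z}/k_1\cdots k_r\mathbb{Z})\bigr|^{w}\prod_{i=1}^r l(p)^{-(s_i-n(p)w)}\,\zeta\!\left(s_i-n(p)w,\tfrac{k_i}{l(p)}\right),$$ where $\zeta(s,q)$ is the Hurwitz zeta function, and it is a meromorphic function of $s_1,\ldots,s_r,w$ (that is, it continues meromorphically to $\mathbb{C}^{r+1}$).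
   Context: A Noetherian $\mathbb{F}_1$-scheme is taken in the sense of Connes-Consani: its underlying space is a topological space with a sheaf of commutative monoids with absorbing zero, admitting a finite open cover by prime spectra of finitely generated such monoids. The only facts about $X$ that matter here are that $X$ has finitely many points and that, for every $p\in X$, the unit group $\mathcal{O}_{X,p}^{\times}$ of the stalk at $p$ is a finitely generated abelian group. $\operatorname{Hom}$ denotes homomorphisms of abelian groups. Here $s_1,\ldots,s_r,w$ are complex variables; the defining series converges absolutely when $\Re(s_i)>1+n(p)\Re(w)$ for all $i$ and all $p\in X$, and the explicit formula is an identity in that region which provides the continuation. The Hurwitz zeta function is $\zeta(s,q)=\sum_{n\ge 0}(n+q)^{-s}$ for $\Re(s)>1$, $\Re(q)>0$, continued meromorphically in $s$ to $\mathbb{C}$. *)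

(* Defs.v *)
From HB Require Import structures.
From mathcomp Require Import all_boot all_order all_algebra all_fingroup.
From mathcomp Require Import all_solvable.
From mathcomp Require Import all_classical all_reals all_analysis.
From mathcomp Require Import finmap complex generic_quotient.
From mathcomp.analysis.showcase Require Import summability.
Set Implicit Arguments.
Unset Strict Implicit.
Unset Printing Implicit Defensive.
Import Order.TTheory GRing.Theory Num.Theory.
Import numFieldNormedType.Exports.
Local Open Scope quotient_scope.
Local Open Scope classical_set_scope.
Local Open Scope ring_scope.

(* The zero monoid (0 = 1) is allowed: it is the value of a sheaf on the
   empty open set. *)
HB.mixin Record Monoid_isPMonoid M of monoid.Monoid M := {
  zerog : M;
  pmulgC : commutative (@monoid.mul M);
  pmul0g : left_zero zerog (@monoid.mul M)
}.

#[short(type="pmonoidType")]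
HB.structure Definition PMonoid := {M of Monoid_isPMonoid M & monoid.Monoid M}.

Definition is_pmorph (M N : pmonoidType) (f : M -> N) : Prop :=
  [/\ f 1%g = 1%g, f zerog = zerog & {morph f : x y / (x * y)%g}].

Definition finitely_generated (M : pmonoidType) : Prop :=
  exists gens : seq M, forall S : set M,
    S 1%g -> S zerog -> (forall x y, S x -> S y -> S (x * y)%g) ->
    (forall x, x \in gens -> S x) -> forall x, S x.

Section Units.
Variable M : pmonoidType.

Record units := Units {
  uval : M;
  uvalP : exists y, (uval * y = 1)%g }.

HB.instance Definition _ := gen_eqMixin units.
HB.instance Definition _ := gen_choiceMixin units.

Lemma uval_inj : injective uval.
Proof.
move=> [x hx] [y hy] /= exy; subst y; congr Units; exact: Prop_irrelevance.
Qed.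

Lemma unit1_subproof : exists y : M, (1 * y = 1)%g.
Proof. by exists 1%g; rewrite mulg1. Qed.

Lemma unitM_subproof (x y : units) : exists z, (uval x * uval y * z = 1)%g.
Proof.
case: x y => [x [x' hx]] [y [y' hy]] /=; exists (y' * x')%g.
by rewrite mulgA -(mulgA x) hy mulg1.
Qed.

Definition uinv_val (x : units) : M := projT1 (cid (uvalP x)).

Lemma uinv_valP x : (uval x * uinv_val x = 1)%g.
Proof. exact: projT2 (cid (uvalP x)). Qed.

Lemma unitV_subproof (x : units) : exists z, (uinv_val x * z = 1)%g.
Proof. by exists (uval x); rewrite pmulgC uinv_valP. Qed.

Definition one_units := Units unit1_subproof.
Definition mul_units x y := Units (unitM_subproof x y).
Definition inv_units x := Units (unitV_subproof x).

Lemma mul_unitsA : associative mul_units.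
Proof. by move=> x y z; apply: uval_inj; rewrite /= mulgA. Qed.
Lemma mul_units1x : left_id one_units mul_units.
Proof. by move=> x; apply: uval_inj; rewrite /= mul1g. Qed.
Lemma mul_unitsx1 : right_id one_units mul_units.
Proof. by move=> x; apply: uval_inj; rewrite /= mulg1. Qed.
Lemma mul_unitsVx : left_inverse one_units inv_units mul_units.
Proof. by move=> x; apply: uval_inj; rewrite /= pmulgC uinv_valP. Qed.
Lemma mul_unitsxV : right_inverse one_units inv_units mul_units.
Proof. by move=> x; apply: uval_inj; rewrite /= uinv_valP. Qed.

HB.instance Definition _ := isGroup.Build units
  mul_unitsA mul_units1x mul_unitsx1 mul_unitsVx mul_unitsxV.

End Units.

Identity Coercion set_pred : set >-> Funclass.

Record opens (X : topologicalType) := Opens {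
  opens_set :> set X;
  opensP : open opens_set }.

Definition opensT (X : topologicalType) : opens X := Opens (@openT X).
Definition opensI (X : topologicalType) (U V : opens X) : opens X :=
  Opens (openI (opensP U) (opensP V)).
Lemma opensIl (X : topologicalType) (U V : opens X) : opensI U V `<=` U.
Proof. exact: subIsetl. Qed.
Lemma opensIr (X : topologicalType) (U V : opens X) : opensI U V `<=` V.
Proof. exact: subIsetr. Qed.
Definition opens_preim (X Y : topologicalType) (f : X -> Y)
    (cf : continuous f) (V : opens Y) : opens X :=
  Opens (proj1 (continuousP f) cf _ (opensP V)).

(* A topological space with a sheaf of commutative monoids with zero; the last
   field is locality and gluing at once. *)
Record monoidal_space := MonoidalSpace {
  mspace :> topologicalType;
  sec : opens mspace -> pmonoidType;
  res : forall U V : opens mspace, V `<=` U -> sec U -> sec V;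
  res_pmorph : forall (U V : opens mspace) (h : V `<=` U),
    is_pmorph (@res U V h);
  res_id : forall (U : opens mspace) (h : U `<=` U) s, @res U U h s = s;
  res_comp : forall (U V W : opens mspace) (hVU : V `<=` U) (hWV : W `<=` V)
    (hWU : W `<=` U) s, res hWV (res hVU s) = res hWU s;
  sec_glue : forall (U : opens mspace) (I : Type) (V : I -> opens mspace)
    (hV : forall i, V i `<=` U) (s : forall i, sec (V i)),
    (U : set mspace) `<=` \bigcup_(i in setT) V i ->
    (forall i j (W : opens mspace) (hi : W `<=` V i) (hj : W `<=` V j),
       res hi (s i) = res hj (s j)) ->
    exists! t : sec U, forall i, res (hV i) t = s i }.

Section Stalk.
Variables (X : monoidal_space) (p : X).

Record germ_rep := GermRep {
  gr_dom : opens X;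
  gr_in : gr_dom p;
  gr_sec : sec gr_dom }.

HB.instance Definition _ := gen_eqMixin germ_rep.
HB.instance Definition _ := gen_choiceMixin germ_rep.

Definition germ_rel (a b : germ_rep) : bool :=
  `[< exists (W : opens X) (ha : W `<=` gr_dom a) (hb : W `<=` gr_dom b),
        W p /\ res ha (gr_sec a) = res hb (gr_sec b) >].

Lemma germ_rel_equiv : equiv_class_of germ_rel.
Proof.
split.
- by move=> a; apply/asboolP; exists (gr_dom a), (@subset_refl _ _),
    (@subset_refl _ _); split; [exact: gr_in|].
- by move=> a b; apply/asboolP/asboolP => -[W [ha [hb [Wp e]]]];
    exists W, hb, ha.
- move=> b a c /asboolP[W [ha [hb [Wp e]]]] /asboolP[V [kb [kc [Vp f]]]].
  apply/asboolP; exists (opensI W V).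
  have sW : opensI W V `<=` W by move=> x [].
  have sV : opensI W V `<=` V by move=> x [].
  exists (subset_trans sW ha), (subset_trans sV kc); split; first by split.
  rewrite -(res_comp ha sW) e (res_comp hb sW (subset_trans sW hb)).
  by rewrite -(res_comp kc sV) -f (res_comp kb sV (subset_trans sW hb)).
Qed.

Canonical germ_equiv := EquivRelPack germ_rel_equiv.

Definition stalk := {eq_quot germ_equiv}.
HB.instance Definition _ := Choice.on stalk.

Definition germ (U : opens X) (hp : U p) (s : sec U) : stalk :=
  \pi_stalk (GermRep hp s).

Lemma germP (x : stalk) : exists (U : opens X) (hp : U p) (s : sec U),
  x = germ hp s.
Proof.
by rewrite -(reprK x); case: (repr x) => U hp s; exists U, hp, s.
Qed.

Lemma germ_eqP (U V : opens X) (hU : U p) (hV : V p) (s : sec U) (t : sec V) :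
  germ hU s = germ hV t <->
  exists (W : opens X) (hs : W `<=` U) (ht : W `<=` V),
    W p /\ res hs s = res ht t.
Proof.
split; first by move=> /eqP; rewrite (@eqmodE _ germ_equiv) => /asboolP.
by move=> h; apply/eqP; rewrite (@eqmodE _ germ_equiv); apply/asboolP.
Qed.

Lemma germ_res (U V : opens X) (hU : U p) (hV : V p) (h : V `<=` U)
  (s : sec U) : germ hV (res h s) = germ hU s.
Proof.
apply/germ_eqP; exists V, (@subset_refl _ _), h; split => //.
by rewrite res_id.
Qed.

Definition mul_rep (a b : germ_rep) : germ_rep :=
  @GermRep (opensI (gr_dom a) (gr_dom b)) (conj (gr_in a) (gr_in b))
    (res (@opensIl _ _ _) (gr_sec a) * res (@opensIr _ _ _) (gr_sec b))%g.

Definition mul_stalk (x y : stalk) : stalk :=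
  \pi_stalk (mul_rep (repr x) (repr y)).
Definition one_stalk : stalk := @germ (opensT X) I 1%g.
Definition zero_stalk : stalk := @germ (opensT X) I zerog.

Lemma germM (U : opens X) (hU : U p) (s t : sec U) :
  mul_stalk (germ hU s) (germ hU t) = germ hU (s * t)%g.
Proof.
rewrite /mul_stalk /mul_rep.
have := reprK (germ hU s); case: (repr (germ hU s)) => A hA a /= es.
have := reprK (germ hU t); case: (repr (germ hU t)) => B hB b /= et.
have /germ_eqP[V [kA [kU [Vp eV]]]] : germ hA a = germ hU s by [].
have /germ_eqP[W [lB [lU [Wp eW]]]] : germ hB b = germ hU t by [].
apply/germ_eqP => /=; exists (opensI V W).
have sV : opensI V W `<=` V by move=> x [].
have sW : opensI V W `<=` W by move=> x [].
have sAB : opensI V W `<=` opensI A B by move=> x [Vx Wx]; split; auto.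
have sU : opensI V W `<=` U by move=> x [/kU].
exists sAB, sU; split; first by [].
have [_ _ ->] := res_pmorph sAB; have [_ _ ->] := res_pmorph sU.
congr (_ * _)%g.
- rewrite (res_comp _ _ (subset_trans sV kA)) -(res_comp kA sV) eV.
  exact: res_comp.
- rewrite (res_comp _ _ (subset_trans sW lB)) -(res_comp lB sW) eW.
  exact: res_comp.
Qed.

Lemma germP2 (x y : stalk) : exists (U : opens X) (hp : U p) (s t : sec U),
  x = germ hp s /\ y = germ hp t.
Proof.
have [U [hU [s ->]]] := germP x; have [V [hV [t ->]]] := germP y.
exists (opensI U V), (conj hU hV), (res (@opensIl _ _ _) s),
  (res (@opensIr _ _ _) t).
by rewrite !germ_res.
Qed.

Lemma germP3 (x y z : stalk) :
  exists (U : opens X) (hp : U p) (s t u : sec U),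
  [/\ x = germ hp s, y = germ hp t & z = germ hp u].
Proof.
have [U [hU [s [t [-> ->]]]]] := germP2 x y; have [V [hV [u ->]]] := germP z.
exists (opensI U V), (conj hU hV), (res (@opensIl _ _ _) s),
  (res (@opensIl _ _ _) t), (res (@opensIr _ _ _) u).
by rewrite !germ_res.
Qed.

Lemma germ1 (U : opens X) (hU : U p) : germ hU 1%g = one_stalk.
Proof.
have h : U `<=` opensT X by [].
rewrite /one_stalk -(germ_res (U := opensT X) I hU h).
by have [-> _ _] := res_pmorph h.
Qed.

Lemma germ0 (U : opens X) (hU : U p) : germ hU zerog = zero_stalk.
Proof.
have h : U `<=` opensT X by [].
rewrite /zero_stalk -(germ_res (U := opensT X) I hU h).
by have [_ -> _] := res_pmorph h.
Qed.

Lemma mul_stalkA : associative mul_stalk.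
Proof.
move=> x y z; have [U [hU [s [t [u [-> -> ->]]]]]] := germP3 x y z.
by rewrite !germM mulgA.
Qed.

Lemma mul_stalkC : commutative mul_stalk.
Proof.
move=> x y; have [U [hU [s [t [-> ->]]]]] := germP2 x y.
by rewrite !germM pmulgC.
Qed.

Lemma mul_stalk1x : left_id one_stalk mul_stalk.
Proof.
by move=> x; have [U [hU [s ->]]] := germP x; rewrite -(germ1 hU) germM mul1g.
Qed.

Lemma mul_stalkx1 : right_id one_stalk mul_stalk.
Proof. by move=> x; rewrite mul_stalkC mul_stalk1x. Qed.

Lemma mul_stalk0x x : mul_stalk zero_stalk x = zero_stalk.
Proof.
by have [U [hU [s ->]]] := germP x; rewrite -(germ0 hU) germM pmul0g.
Qed.

HB.instance Definition _ := isMonoid.Build stalk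
  mul_stalkA mul_stalk1x mul_stalkx1.
HB.instance Definition _ := Monoid_isPMonoid.Build stalk
  mul_stalkC mul_stalk0x.

End Stalk.

Record spec (M : pmonoidType) := PrimeIdeal {
  pideal :> set M;
  pideal0 : pideal zerog;
  pidealM : forall x a, pideal a -> pideal (x * a)%g;
  pideal1 : ~ pideal 1%g;
  pideal_prime : forall x y, pideal (x * y)%g -> pideal x \/ pideal y }.

Section SpecTopology.
Variable M : pmonoidType.

HB.instance Definition _ := gen_eqMixin (spec M).
HB.instance Definition _ := gen_choiceMixin (spec M).

(* The closed sets are the V(E) = {p | E `<=` p}. *)
Definition spec_open (U : set (spec M)) : Prop :=
  exists E : set M, U = [set p : spec M | ~ (E `<=` p)].

Lemma spec_openT : spec_open setT.
Proof.
exists [set 1%g]; apply/seteqP; split => // p _ /= h.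
by apply: (@pideal1 _ p); apply: h.
Qed.

Lemma spec_openI : setI_closed spec_open.
Proof.
move=> U V [E ->] [F ->].
exists [set z | exists x y, [/\ E x, F y & z = (x * y)%g]].
apply/seteqP; split => p /=.
- move=> [hE hF] h.
  have /existsNP[x /not_implyP[Ex px]] : ~ (forall x, E x -> p x) by [].
  have /existsNP[y /not_implyP[Fy py]] : ~ (forall x, F x -> p x) by [].
  have /pideal_prime[//|//] : p (x * y)%g by apply: h; exists x, y.
- move=> h; split => hE; apply: h => z [x [y [Ex Fy ->]]].
  + by rewrite pmulgC; apply: pidealM; apply: hE.
  + by apply: pidealM; apply: hE.
Qed.

Lemma spec_open_bigU (I : Type) (f : I -> set (spec M)) :
  (forall i, spec_open (f i)) -> spec_open (\bigcup_i f i).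
Proof.
move=> /choice[E hE]; exists (\bigcup_i E i); apply/seteqP; split => p /=.
- by move=> [i _]; rewrite hE /= => h k; apply: h => x Ex; apply: k; exists i.
- move=> h; apply: contrapT => k; apply: h => x [i _ Ex].
  apply: contrapT => px; apply: k; exists i => //; rewrite hE /= => l.
  by apply: px; apply: l.
Qed.

HB.instance Definition _ := isOpenTopological.Build (spec M)
  spec_openT spec_openI spec_open_bigU.

End SpecTopology.

Section Localization.
Variables (M : pmonoidType) (p : spec M).

(* The localization of M at p: fractions a / f with f outside p, where
   a / f = b / g iff h g a = h f b for some h outside p. *)
Record frac_rep := FracRep {
  fnum : M;
  fden : M;
  fdenP : ~ p fden }.

HB.instance Definition _ := gen_eqMixin frac_rep.
HB.instance Definition _ := gen_choiceMixin frac_rep.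

Definition frac_rel (x y : frac_rep) : bool :=
  `[< exists h, ~ p h /\ (h * fden y * fnum x = h * fden x * fnum y)%g >].

Lemma not_pidealM x y : ~ p x -> ~ p y -> ~ p (x * y)%g.
Proof. by move=> px py /pideal_prime[]. Qed.

Lemma frac_rel_equiv : equiv_class_of frac_rel.
Proof.
split.
- by move=> x; apply/asboolP; exists 1%g; split => //; exact: pideal1.
- by move=> x y; apply/asboolP/asboolP => -[h [ph e]]; exists h.
- move=> y x z /asboolP[h [ph e]] /asboolP[k [pk f]]; apply/asboolP.
  exists (h * k * fden y)%g; split.
    by apply: not_pidealM; [exact: not_pidealM|exact: fdenP].
  have -> : (h * k * fden y * fden z * fnum x =
      k * fden z * (h * fden y * fnum x))%g.
    rewrite (pmulgC h k) -!mulgA; congr (_ * _)%g; rewrite !mulgA.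
    by rewrite (pmulgC _ (fden z)) !mulgA.
  rewrite e.
  have -> : (k * fden z * (h * fden x * fnum y) =
      h * fden x * (k * fden z * fnum y))%g.
    by rewrite !mulgA (pmulgC (k * fden z)%g) -!mulgA; congr (_ * _)%g;
      rewrite !mulgA (pmulgC _ (fden x)) !mulgA.
  rewrite f !mulgA; congr (_ * _)%g; rewrite -!mulgA; congr (_ * _)%g.
  by rewrite (pmulgC (fden x)) -!mulgA.
Qed.

Canonical frac_equiv := EquivRelPack frac_rel_equiv.

Definition loc := {eq_quot frac_equiv}.
HB.instance Definition _ := Choice.on loc.

Definition frac (a f : M) (pf : ~ p f) : loc := \pi_loc (@FracRep a f pf).

Lemma fracP (x : loc) : exists a f (pf : ~ p f), x = frac a pf.
Proof. by rewrite -(reprK x); case: (repr x) => a f pf; exists a, f, pf. Qed.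

Lemma frac_eqP a f b g (pf : ~ p f) (pg : ~ p g) :
  frac a pf = frac b pg <-> exists h, ~ p h /\ (h * g * a = h * f * b)%g.
Proof.
split; first by move=> /eqP; rewrite (@eqmodE _ frac_equiv) => /asboolP.
by move=> h; apply/eqP; rewrite (@eqmodE _ frac_equiv); apply/asboolP.
Qed.

Definition mul_loc (x y : loc) : loc :=
  frac (fnum (repr x) * fnum (repr y))%g
    (not_pidealM (@fdenP (repr x)) (@fdenP (repr y))).
Definition one_loc : loc := frac 1%g (@pideal1 _ p).
Definition zero_loc : loc := frac zerog (@pideal1 _ p).

Lemma fracM a f b g (pf : ~ p f) (pg : ~ p g) :
  mul_loc (frac a pf) (frac b pg) = frac (a * b)%g (not_pidealM pf pg).
Proof.
rewrite /mul_loc.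
have := reprK (frac a pf); case: (repr (frac a pf)) => a' f' pf' /= ea.
have := reprK (frac b pg); case: (repr (frac b pg)) => b' g' pg' /= eb.
have /frac_eqP[h [ph eh]] : frac a' pf' = frac a pf by [].
have /frac_eqP[k [pk ek]] : frac b' pg' = frac b pg by [].
apply/frac_eqP; exists (h * k)%g; split; first exact: not_pidealM.
have mulACA : forall x y z t u v : M,
    (x * y * (z * t) * (u * v) = x * z * u * (y * t * v))%g.
  move=> x y z t u v; rewrite -!mulgA; congr (_ * _)%g.
  rewrite !mulgA (pmulgC y z) -!mulgA; congr (_ * _)%g.
  by rewrite !mulgA (pmulgC _ u) !mulgA.
by rewrite !mulACA eh ek.
Qed.

Lemma mul_locC : commutative mul_loc.
Proof.
move=> x y; have [a [f [pf ->]]] := fracP x; have [b [g [pg ->]]] := fracP y.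
rewrite !fracM; apply/frac_eqP; exists 1%g; split; first exact: pideal1.
by rewrite (pmulgC a) (pmulgC f).
Qed.

Lemma mul_locA : associative mul_loc.
Proof.
move=> x y z; have [a [f [pf ->]]] := fracP x; have [b [g [pg ->]]] := fracP y.
have [c [h [ph ->]]] := fracP z.
rewrite !fracM; apply/frac_eqP; exists 1%g; split; first exact: pideal1.
by rewrite !mulgA.
Qed.

Lemma mul_loc1x : left_id one_loc mul_loc.
Proof.
move=> x; have [a [f [pf ->]]] := fracP x.
rewrite !fracM; apply/frac_eqP; exists 1%g; split; first exact: pideal1.
by rewrite !mul1g.
Qed.

Lemma mul_locx1 : right_id one_loc mul_loc.
Proof. by move=> x; rewrite mul_locC mul_loc1x. Qed.

Lemma mul_loc0x x : mul_loc zero_loc x = zero_loc.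
Proof.
have [a [f [pf ->]]] := fracP x.
rewrite !fracM; apply/frac_eqP; exists 1%g; split; first exact: pideal1.
by rewrite pmul0g !(pmulgC _ zerog) !pmul0g.
Qed.

HB.instance Definition _ := isMonoid.Build loc
  mul_locA mul_loc1x mul_locx1.
HB.instance Definition _ := Monoid_isPMonoid.Build loc mul_locC mul_loc0x.

End Localization.

Section SpecSections.
Variables (M : pmonoidType) (U : opens (spec M)).

Definition locally_fraction (s : forall q : spec M, U q -> loc q) : Prop :=
  forall q, U q -> exists (W : opens (spec M)) (a f : M), W q /\
    forall q' (hq' : U q'), W q' ->
      exists pf : ~ q' f, s q' hq' = frac a pf.

Record spec_sec := SpecSec {
  spec_sec_val :> forall q : spec M, U q -> loc q;
  spec_sec_valP : locally_fraction spec_sec_val }.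

HB.instance Definition _ := gen_eqMixin spec_sec.
HB.instance Definition _ := gen_choiceMixin spec_sec.

Lemma spec_sec_ext (s t : spec_sec) :
  (forall q (hq : U q), s q hq = t q hq) -> s = t.
Proof.
case: s t => [s hs] [t ht] /= e.
have est : s = t by apply: functional_extensionality_dep => q;
  apply: functional_extensionality_dep => hq; exact: e.
subst t; congr SpecSec; exact: Prop_irrelevance.
Qed.

Lemma cst_sec_subproof (a : M) :
  locally_fraction (fun q (_ : U q) => frac a (@pideal1 _ q)).
Proof.
move=> q hq; exists (opensT _), a, 1%g; split => // q' hq' _.
by exists (@pideal1 _ q').
Qed.

Lemma mul_sec_subproof (s t : spec_sec) :
  locally_fraction (fun q (hq : U q) => (s q hq * t q hq)%g).
Proof.
move=> q hq; have [W [a [f [Wq hs]]]] := spec_sec_valP s hq.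
have [V [b [g [Vq ht]]]] := spec_sec_valP t hq.
exists (opensI W V), (a * b)%g, (f * g)%g; split => // q' hq' [Wq' Vq'].
have [pf ->] := hs q' hq' Wq'; have [pg ->] := ht q' hq' Vq'.
by exists (not_pidealM pf pg); rewrite -fracM.
Qed.

Definition one_sec := SpecSec (cst_sec_subproof 1%g).
Definition zero_sec := SpecSec (cst_sec_subproof zerog).
Definition mul_sec s t := SpecSec (mul_sec_subproof s t).

Lemma mul_secA : associative mul_sec.
Proof. by move=> s t u; apply: spec_sec_ext => q hq /=; rewrite mulgA. Qed.
Lemma mul_secC : commutative mul_sec.
Proof. by move=> s t; apply: spec_sec_ext => q hq /=; rewrite pmulgC. Qed.
Lemma mul_sec1x : left_id one_sec mul_sec.
Proof. by move=> s; apply: spec_sec_ext => q hq /=; exact: mul_loc1x. Qed.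
Lemma mul_secx1 : right_id one_sec mul_sec.
Proof. by move=> s; rewrite mul_secC mul_sec1x. Qed.
Lemma mul_sec0x s : mul_sec zero_sec s = zero_sec.
Proof. by apply: spec_sec_ext => q hq /=; exact: mul_loc0x. Qed.

HB.instance Definition _ := isMonoid.Build spec_sec
  mul_secA mul_sec1x mul_secx1.
HB.instance Definition _ := Monoid_isPMonoid.Build spec_sec
  mul_secC mul_sec0x.

End SpecSections.

Section SpecSpace.
Variable M : pmonoidType.

Lemma res_spec_subproof (U V : opens (spec M)) (h : V `<=` U)
  (s : spec_sec U) : locally_fraction (fun q (hq : V q) => s q (h q hq)).
Proof.
move=> q hq; have [W [a [f [Wq hs]]]] := spec_sec_valP s (h q hq).
by exists W, a, f; split => // q' hq' Wq'; exact: hs.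
Qed.

Definition res_spec (U V : opens (spec M)) (h : V `<=` U) (s : spec_sec U) :
  spec_sec V := SpecSec (res_spec_subproof h s).

Lemma res_spec_pmorph (U V : opens (spec M)) (h : V `<=` U) :
  is_pmorph (res_spec h).
Proof. by split=> [||s t]; exact: spec_sec_ext. Qed.

Lemma res_spec_id (U : opens (spec M)) (h : U `<=` U) s : res_spec h s = s.
Proof.
apply: spec_sec_ext => q hq /=.
by congr (spec_sec_val s _); exact: Prop_irrelevance.
Qed.

Lemma res_spec_comp (U V W : opens (spec M)) (hVU : V `<=` U)
  (hWV : W `<=` V) (hWU : W `<=` U) s :
  res_spec hWV (res_spec hVU s) = res_spec hWU s.
Proof.
apply: spec_sec_ext => q hq /=.
by congr (spec_sec_val s _); exact: Prop_irrelevance.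
Qed.

Lemma spec_glue (U : opens (spec M)) (I : Type) (V : I -> opens (spec M))
    (hV : forall i, V i `<=` U) (s : forall i, spec_sec (V i)) :
  (U : set _) `<=` \bigcup_(i in setT) V i ->
  (forall i j (W : opens (spec M)) (hi : W `<=` V i) (hj : W `<=` V j),
     res_spec hi (s i) = res_spec hj (s j)) ->
  exists! t : spec_sec U, forall i, res_spec (hV i) t = s i.
Proof.
move=> cov comp.
have agree i j q (hi : V i q) (hj : V j q) : s i q hi = s j q hj.
  pose W := opensI (V i) (V j); pose hW : W q := conj hi hj.
  have := comp i j W (@opensIl _ _ _) (@opensIr _ _ _).
  move=> /(congr1 (fun t : spec_sec W => t q hW)) /= e.
  have -> : hi = opensIl hW by exact: Prop_irrelevance.
  by rewrite e; congr (spec_sec_val _ _); exact: Prop_irrelevance.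
have ex q (hq : U q) : {i | V i q}.
  by apply: cid; have [i _ Vi] := cov q hq; exists i.
pose t q (hq : U q) : loc q := s (projT1 (ex q hq)) q (projT2 (ex q hq)).
have tE i q (hq : U q) (hi : V i q) : t q hq = s i q hi by exact: agree.
have tP : locally_fraction t.
  move=> q hq; have [i hi] := ex q hq.
  have [W [a [f [Wq hs]]]] := spec_sec_valP (s i) hi.
  exists (opensI W (V i)), a, f; split => // q' hq' [Wq' hi'].
  by rewrite (tE i q' hq' hi'); exact: hs.
exists (SpecSec tP); split.
  by move=> i; apply: spec_sec_ext => q hq /=; exact: tE.
move=> u hu; apply: spec_sec_ext => q hq /=; have [i hi] := ex q hq.
rewrite (tE i q hq hi) -(hu i) /=.
by congr (spec_sec_val u _); exact: Prop_irrelevance.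
Qed.

Definition Spec : monoidal_space :=
  @MonoidalSpace (spec M) (fun U => spec_sec U) res_spec res_spec_pmorph
    res_spec_id res_spec_comp spec_glue.

End SpecSpace.

Lemma opens_preimS (X Y : topologicalType) (f : X -> Y) (cf : continuous f)
  (U V : opens Y) : V `<=` U -> opens_preim cf V `<=` opens_preim cf U.
Proof. by move=> h x; exact: h. Qed.

(* (f, theta) is an isomorphism from Y onto the open subspace of X carried by
   U; U itself is forced to be open because f is an open map. *)
Definition open_immersion_onto (X Y : monoidal_space) (U : set X)
    (f : Y -> X) (cf : continuous f)
    (theta : forall V : opens X, sec V -> sec (opens_preim cf V)) : Prop :=
  [/\ injective f, f @` setT = U,
      (forall W : set Y, open W -> open (f @` W)),
      (forall V, is_pmorph (theta V)) /\
      (forall (V V' : opens X) (h : V' `<=` V) (s : sec V),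
         theta V' (res h s) = res (opens_preimS h) (theta V s)) &
      (forall V : opens X, V `<=` U -> bijective (theta V))].

Definition affine_open (X : monoidal_space) (U : set X) (M : pmonoidType) :=
  exists (f : Spec M -> X) (cf : continuous f)
    (theta : forall V : opens X, sec V -> sec (opens_preim cf V)),
    open_immersion_onto U theta.

Definition noetherian_F1_scheme (X : monoidal_space) : Prop :=
  exists (k : nat) (U : 'I_k -> set X) (M : 'I_k -> pmonoidType),
    [/\ \bigcup_(i in setT) U i = setT,
        (forall i, finitely_generated (M i)) &
        (forall i, affine_open (U i) (M i))].

(* |Hom(G, Z/m)| for m >= 1. The additive group Z/m is carried by 'I_m, which
   is a zmodType only for a syntactic successor, whence 'I_m.-1.+1; note that
   'Z_1 would denote Z/2. *)
Definition num_hom (G : groupType) (m : nat) : nat :=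
  #|` fset_set [set f : G -> 'I_m.-1.+1 |
        forall x y : G, f (x * y)%g = (f x + f y)%R] |%fset.

Definition splits_as (G : groupType) (n : nat) (Gam : finGroupType) : Prop :=
  exists phi : G -> 'rV[int]_n * Gam, bijective phi /\
    forall x y : G, phi (x * y)%g =
      ((phi x).1 + (phi y).1, ((phi x).2 * (phi y).2)%g).

(* R[i] seen as a normed space over itself. *)
Notation Cplx R := (R[i]^o).

Section ComplexAnalysis.
Variable R : realType.

Definition cexp (z : Cplx R) : Cplx R :=
  (expR (complex.Re z) * cos (complex.Im z)
   +i* (expR (complex.Re z) * sin (complex.Im z)))%C.

(* x ^ s for a real x > 0. *)
Definition cpow (x : R) (s : Cplx R) : Cplx R := cexp (s * (ln x)%:C%C).

Definition holomorphic_on (V : normedModType R[i]) (D : set V)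
    (f : V -> Cplx R) : Prop :=
  forall z, D z -> differentiable f z.

(* Locally a quotient g / h of holomorphic functions, h vanishing identically
   on no nonempty open set. *)
Definition meromorphic (V : normedModType R[i]) (f : V -> Cplx R) : Prop :=
  forall a : V, exists (U : set V) (g h : V -> Cplx R),
    [/\ open_nbhs a U, holomorphic_on U g, holomorphic_on U h,
        (forall W : set V, open W -> W `<=` U -> W !=set0 ->
           exists2 z, W z & h z != 0) &
        (forall z, U z -> h z != 0 -> f z = g z / h z)].

Definition hurwitz_series (q : R) (s : Cplx R) : Cplx R :=
  lim (series (fun k : nat => cpow (k%:R + q) (- s) : Cplx R) @ \oo).

Definition is_hurwitz (q : R) (Z : Cplx R -> Cplx R) : Prop :=
  [/\ (forall s, 1 < complex.Re s -> Z s = hurwitz_series q s),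
      holomorphic_on [set s : Cplx R | s != 1] Z & meromorphic Z].

(* The meromorphic continuation to C of the Hurwitz series, for a real q > 0.
   It is determined by is_hurwitz except for its value at the pole s = 1,
   which is left unspecified. *)
Definition hurwitz_zeta (s : Cplx R) (q : R) : Cplx R :=
  xget (fun=> 0) [set Z | is_hurwitz q Z] s.

End ComplexAnalysis.

Section Igusa.
Variables (R : realType) (X : monoidal_space) (r : nat).

(* The summation index a stands for (m_1, ..., m_r) = (a_1 + 1, ..., a_r + 1),
   and s_(i+1) is s 0 i. *)
Definition igusa_term (s : 'rV[Cplx R]_r) (w : Cplx R) (p : X)
    (a : {ffun 'I_r -> nat}) : Cplx R :=
  cpow (num_hom (units (stalk p)) (\prod_i (a i).+1)%N)%:R w
  * \prod_i cpow (a i).+1%:R (- s 0 i).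

Definition igusa_zeta (s : 'rV[Cplx R]_r) (w : Cplx R) : Cplx R :=
  \sum_(p \in [set: X]) summability.sum (igusa_term s w p).

Definition igusa_abs_cvg (s : 'rV[Cplx R]_r) (w : Cplx R) : Prop :=
  forall p : X,
    (\esum_(a in [set: {ffun 'I_r -> nat}])
       (complex.Re `|igusa_term s w p a|)%:E < +oo)%E.

Variables (n : X -> nat) (Gam : X -> finGroupType).

Definition igusa_region (s : 'rV[Cplx R]_r) (w : Cplx R) : Prop :=
  forall (i : 'I_r) (p : X),
    complex.Re (s 0 i) > 1 + (n p)%:R * complex.Re w.

(* exponent [set: Gam p] is the lcm of the orders of the elements of Gam p;
   the index k stands for (k_1, ..., k_r) = (k 1 + 1, ..., k r + 1). *)
Definition igusa_formula (s : 'rV[Cplx R]_r) (w : Cplx R) : Cplx R :=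
  \sum_(p \in [set: X])
    let l := exponent [set: Gam p]%SET in
    \sum_(k : {ffun 'I_r -> 'I_l})
      cpow (num_hom (Gam p) (\prod_i (k i).+1)%N)%:R w
      * \prod_i (cpow l%:R (- (s 0 i - (n p)%:R * w))
                 * hurwitz_zeta (s 0 i - (n p)%:R * w) ((k i).+1%:R / l%:R)).

End Igusa.

(* Main.v *)
Require Import Defs.
From HB Require Import structures.
From mathcomp Require Import all_boot all_order all_algebra all_fingroup.
From mathcomp Require Import all_solvable.
From mathcomp Require Import all_classical all_reals all_analysis.
From mathcomp Require Import complex.
From mathcomp Require Import finmap ring lra.
From mathcomp.analysis.showcase Require Import summability.
Set Implicit Arguments.
Unset Strict Implicit.
Unset Printing Implicit Defensive.
Import Order.TTheory GRing.Theory Num.Theory.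
Import numFieldNormedType.Exports.
Import ComplexField.Normc.
Local Open Scope classical_set_scope.
Local Open Scope ring_scope.

(** A prime ideal of a finitely generated monoid is determined by the generators
    it contains, so X is finite. At a point p, |Hom(Z^n x Gam, Z/m)| equals
    m^n |Hom(Gam, Z/m)|, and the second factor depends only on m modulo
    l = exp(Gam), since Hom(Gam, Z/m) = Hom(Gam, Z/gcd(l, m)). Sorting the m_i by
    residue classes modulo l thus expresses the sum at p by products of Hurwitz
    series.

    Meromorphy reduces to the continuation of the Hurwitz zeta function, obtained
    by telescoping. Let E be the shift of step 1. As d/dx = log(1 + (E - 1)),
    (1 - s) x^(-s) is the derivative of x^(1 - s), and truncating the logarithm at
    order K approximates it by (E - 1) beta_K(E) x^(1 - s) with an error
    O(x^(- Re s - K)). Summed over x = q, q + 1, ..., the main terms telescope to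
    - beta_K(E) q^(1 - s), an entire function of s, and the errors converge
    for Re s > 1 - K. *)

(* Two obstacles shape the continuation. For fixed K the error series is controlled only on a half
   plane, so the values for different K have to be shown equal wherever both are available.
   Consecutive orders differ by a boundary term that tends to 0; hence K may be chosen as a function
   of s.

   The sum must moreover be holomorphic in s. Every estimate is therefore made for a first-order
   expansion in s with quadratic error on a unit disc, and the constants of these expansions are
   summed along the series. This costs up to three powers of x, and summability is obtained from
   x^(-2), whence the bound Re(1 - s) + 5 <= K + 1 in the code, stronger than Re s > 1 - K.

   Since [hurwitz_zeta] is selected among the functions satisfying [is_hurwitz], exhibiting one such
   function transfers these properties to it. *)
#[local] Existing Instance totally_filter.

(** * Complex norm and series *)

Section ComplexNorm.
Variable R : realType.
Implicit Types (x y z : R[i]) (a b : R).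

Lemma normrE z : `|z| = (normc z)%:C%C.
Proof. by []. Qed.

Lemma normc_ge0 z : 0 <= normc z.
Proof. by case: z => a b /=; exact: sqrtr_ge0. Qed.

Lemma normc_eq0 z : (normc z == 0) = (z == 0).
Proof. by apply/eqP/eqP => [/eq0_normc//|->]; rewrite normc0. Qed.

Lemma normcB x y : normc (x - y) = normc (y - x).
Proof. by rewrite -normcN opprB. Qed.

Lemma le_normcB x y : normc (x - y) <= normc x + normc y.
Proof. by rewrite -(normcN y); exact: le_normcD. Qed.

Lemma normcR a : normc a%:C%C = `|a|.
Proof. by rewrite /= expr0n addr0 sqrtr_sqr. Qed.

Lemma normcX z n : normc (z ^+ n) = normc z ^+ n.
Proof. by elim: n => [|n IH]; rewrite ?normc1// !exprS normcM IH. Qed.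

Lemma normRe_le z : `|complex.Re z| <= normc z.
Proof.
by case: z => a b /=; rewrite -sqrtr_sqr ler_wsqrtr// lerDl sqr_ge0.
Qed.

Lemma normIm_le z : `|complex.Im z| <= normc z.
Proof.
by case: z => a b /=; rewrite -sqrtr_sqr ler_wsqrtr// lerDr sqr_ge0.
Qed.

Lemma normc_leD z : normc z <= `|complex.Re z| + `|complex.Im z|.
Proof.
have {1}-> : z = (complex.Re z)%:C%C + 'i%C * (complex.Im z)%:C%C.
  exact: complexE.
apply: le_trans (le_normcD _ _) _; rewrite normcM !normcR.
suff -> : normc 'i%C = 1 :> R by rewrite mul1r.
by rewrite /= expr0n expr1n add0r sqrtr1.
Qed.

Lemma le_normc_sum (I : Type) (s : seq I) (P : pred I) (F : I -> R[i]) :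
  normc (\sum_(i <- s | P i) F i) <= \sum_(i <- s | P i) normc (F i).
Proof.
apply: (big_ind2 (fun x (y : R) => normc x <= y)) => //; first by rewrite normc0.
by move=> x1 y1 x2 y2 h1 h2; apply: le_trans (le_normcD _ _) _; exact: lerD.
Qed.

(** A positive element of R[i] is a positive real, so real tolerances suffice; all estimates can
    then be made in the ordered field R. *)
Lemma cvg_normcP (T : Type) (F : set_system T) (FF : Filter F)
  (f : T -> Cplx R) (l : Cplx R) :
  f @ F --> l <-> (forall e : R, 0 < e -> \forall t \near F, normc (l - f t) < e).
Proof.
split=> [/cvgrPdist_lt h e e0|h].
  have : \forall t \near F, `|l - f t| < (e%:C%C : R[i]).
    by apply: h; rewrite ltcR.
  by apply: filterS => t; rewrite normrE ltcR.
apply/cvgrPdist_lt => e e0.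
have e0' : 0 < complex.Re e by move: e0; rewrite ltcE /= => /andP[].
have eE : e = (complex.Re e)%:C%C by rewrite RRe_real// gtr0_real.
by apply: filterS (h _ e0') => t ht; rewrite eE normrE ltcR.
Qed.

Lemma cvg_normc (T : Type) (F : set_system T) (FF : Filter F)
  (f : T -> Cplx R) (l : Cplx R) :
  f @ F --> l -> (fun t => normc (f t)) @ F --> normc l.
Proof.
move=> /cvg_normcP h; apply/cvgrPdist_lt => e e0.
apply: filterS (h e e0) => t; apply: le_lt_trans.
have /= h1 := le_normcD (l - f t) (f t).
have /= h2 := le_normcD (f t - l) l.
rewrite ler_norml; rewrite !subrK (normcB (f t)) in h1 h2.
by apply/andP; split; lra.
Qed.

Lemma cvg_limC (T : Type) (F : set_system T) (FF : ProperFilter F)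
  (f : T -> Cplx R) (l : Cplx R) : f @ F --> l -> lim (f @ F) = l.
Proof. by move=> h; rewrite (cvg_lim _ h)//; exact: norm_hausdorff. Qed.

Lemma cvg_ReIm (T : Type) (F : set_system T) (FF : Filter F)
  (f : T -> Cplx R) (l : Cplx R) :
  (fun t => complex.Re (f t)) @ F --> complex.Re l ->
  (fun t => complex.Im (f t)) @ F --> complex.Im l -> f @ F --> l.
Proof.
move=> /cvgrPdist_lt h1 /cvgrPdist_lt h2; apply/cvg_normcP => e e0.
have e2 : 0 < e / 2 by lra.
apply: filterS2 (h1 _ e2) (h2 _ e2) => t a b.
apply: le_lt_trans (normc_leD _) _.
by rewrite (raddfB (@complex.Re R)) (raddfB (@complex.Im R)) /=; lra.
Qed.

Lemma cvg_series_normc (u : nat -> Cplx R) :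
  cvgn (series (fun n => normc (u n))) -> cvgn (series u).
Proof.
move=> h.
have re : cvgn (series (fun n => complex.Re (u n))).
  apply: normed_cvg; apply: series_le_cvg h => n //=; first exact: normc_ge0.
  exact: normRe_le.
have im : cvgn (series (fun n => complex.Im (u n))).
  apply: normed_cvg; apply: series_le_cvg h => n //=; first exact: normc_ge0.
  exact: normIm_le.
apply/cvg_ex; exists (limn (series (fun n => complex.Re (u n))) +i*
  limn (series (fun n => complex.Im (u n))))%C.
apply: cvg_ReIm => /=.
  suff -> : (fun t => complex.Re (series u t)) = series (fun n => complex.Re (u n)).
    exact: re.
  by apply/funext => n; rewrite /series /= raddf_sum.
suff -> : (fun t => complex.Im (series u t)) = series (fun n => complex.Im (u n)).
  exact: im.
by apply/funext => n; rewrite /series /= raddf_sum.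
Qed.

Lemma normc_series_le (u : nat -> Cplx R) (A : nat -> R) :
  (forall n, normc (u n) <= A n) -> cvgn (series A) ->
  normc (limn (series u)) <= limn (series A).
Proof.
move=> uA cA.
have cn : cvgn (series (fun n => normc (u n))).
  by apply: series_le_cvg cA => // n; [exact: normc_ge0|exact: le_trans (normc_ge0 _) (uA n)].
have cu := cvg_series_normc cn.
have cl : (fun n => normc (series u n)) @ \oo --> normc (limn (series u)) by apply: cvg_normc.
rewrite -(cvg_lim _ cl)//; apply: ler_lim => //; first by apply/cvg_ex; exists (normc (limn (series u))).
near=> n; apply: le_trans (le_normc_sum _ _ _) _.
by rewrite /series /=; exact: ler_sum.
Unshelve. all: by end_near. Qed.

End ComplexNorm.

(** * Complex powers *)

Section ComplexPow.
Variable R : realType.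
Implicit Types (x y z s : Cplx R) (a b t : R).

Lemma cexp0 : cexp 0 = 1 :> Cplx R.
Proof. by rewrite /cexp /= expR0 cos0 sin0 mulr1 mulr0. Qed.

Lemma cexpD x y : cexp (x + y) = cexp x * cexp y.
Proof.
case: x y => [a b] [c d]; rewrite /cexp /= expRD cosD sinD.
by apply/eqP; rewrite eq_complex /=; apply/andP; split; apply/eqP; ring.
Qed.

Lemma normc_cexp z : normc (cexp z) = expR (complex.Re z).
Proof.
case: z => a b; rewrite /cexp /= !exprMn -mulrDr cos2Dsin2 mulr1 sqrtr_sqr.
by rewrite ger0_norm// expR_ge0.
Qed.

Lemma cpowD t x y : cpow t (x + y) = cpow t x * cpow t y.
Proof. by rewrite /cpow mulrDl cexpD. Qed.

Lemma cpow0 t : cpow t 0 = 1.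
Proof. by rewrite /cpow mul0r cexp0. Qed.

Lemma cpow1l x : cpow 1 x = 1 :> Cplx R.
Proof. by rewrite /cpow ln1 mulr0 cexp0. Qed.

Lemma cpowMl a b x : 0 < a -> 0 < b -> cpow (a * b) x = cpow a x * cpow b x.
Proof. by move=> a0 b0; rewrite /cpow lnM// rmorphD mulrDr cexpD. Qed.

Lemma cpowr1 t : 0 < t -> cpow t 1 = t%:C%C :> Cplx R.
Proof.
move=> t0; rewrite /cpow mul1r /cexp /= cos0 sin0 mulr1 mulr0 lnK//.
Qed.

Lemma cpowXl a n x : 0 < a -> cpow (a ^+ n) x = cpow a (n%:R * x).
Proof.
move=> a0; elim: n => [|n IH]; first by rewrite mul0r cpow0 cpow1l.
by rewrite exprS cpowMl ?exprn_gt0// IH -cpowD -(natr1 n) mulrDl mul1r addrC.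
Qed.

Lemma cpow_prod (I : Type) (s : seq I) (f : I -> R) x : (forall i, 0 < f i) ->
  cpow (\prod_(i <- s) f i) x = \prod_(i <- s) cpow (f i) x.
Proof.
move=> f0; elim: s => [|i s IH]; first by rewrite !big_nil cpow1l.
by rewrite !big_cons cpowMl ?IH// prodr_gt0.
Qed.

Lemma normc_cpow t x : normc (cpow t x) = expR (complex.Re x * ln t).
Proof. by case: x => a b; rewrite /cpow normc_cexp /= mulr0 subr0. Qed.

Lemma normc_cpow_powR t x : 0 < t -> normc (cpow t x) = t `^ complex.Re x.
Proof. by move=> t0; rewrite normc_cpow /powR gt_eqF. Qed.

Lemma cpowS t x : 0 < t -> cpow t (x + 1) = cpow t x * t%:C%C.
Proof. by move=> t0; rewrite cpowD cpowr1. Qed.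

(** The variable is real and the value complex. Taking the derivative on real and imaginary parts
    gives access to the real mean value theorem. *)
Definition cderive (f : R -> Cplx R) (t : R) (df : Cplx R) :=
  is_derive t 1 (fun u => complex.Re (f u)) (complex.Re df) /\
  is_derive t 1 (fun u => complex.Im (f u)) (complex.Im df).

Lemma cderiveD f g t df dg : cderive f t df -> cderive g t dg ->
  cderive (fun u => f u + g u) t (df + dg).
Proof.
move=> [f1 f2] [g1 g2]; split.
  have -> : complex.Re (df+dg) = complex.Re df + complex.Re dg by case: df dg {f1 f2 g1 g2} => [? ?] [? ?].
  suff -> : (fun u => complex.Re (f u + g u)) =
    ((fun u => complex.Re (f u)) + (fun u => complex.Re (g u))) by exact: is_deriveD.
  by apply/funext => u; rewrite !fctE; case: (f u) (g u) => [? ?] [? ?].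
have -> : complex.Im (df+dg) = complex.Im df + complex.Im dg by case: df dg {f1 f2 g1 g2} => [? ?] [? ?].
suff -> : (fun u => complex.Im (f u + g u)) =
  ((fun u => complex.Im (f u)) + (fun u => complex.Im (g u))) by exact: is_deriveD.
by apply/funext => u; rewrite !fctE; case: (f u) (g u) => [? ?] [? ?].
Qed.

Lemma cderiveM f g t df dg : cderive f t df -> cderive g t dg ->
  cderive (fun u => f u * g u) t (df * g t + f t * dg).
Proof.
move=> [f1 f2] [g1 g2]; split.
  have -> : (fun u => complex.Re (f u * g u)) =
    ((fun u => complex.Re (f u)) * (fun u => complex.Re (g u)))
    - ((fun u => complex.Im (f u)) * (fun u => complex.Im (g u))).
    by apply/funext => u; rewrite !fctE; case: (f u) (g u) => [? ?] [? ?].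
  apply: is_derive_eq.
  case: (f t) df (g t) dg {f1 f2 g1 g2} => [? ?] [? ?] [? ?] [? ?].
  by rewrite /= /GRing.scale /=; ring.
have -> : (fun u => complex.Im (f u * g u)) =
    ((fun u => complex.Re (f u)) * (fun u => complex.Im (g u)))
    + ((fun u => complex.Im (f u)) * (fun u => complex.Re (g u))).
  by apply/funext => u; rewrite !fctE; case: (f u) (g u) => [? ?] [? ?].
apply: is_derive_eq.
case: (f t) df (g t) dg {f1 f2 g1 g2} => [? ?] [? ?] [? ?] [? ?].
by rewrite /= /GRing.scale /=; ring.
Qed.

Lemma cderive_real (f : R -> R) t df : is_derive t 1 f df ->
  cderive (fun u => (f u)%:C%C) t df%:C%C.
Proof. by move=> h; split => //=; exact: is_derive_cst. Qed.

Lemma cderive_cst z t : cderive (fun=> z) t 0.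
Proof. by split => /=; exact: is_derive_cst. Qed.

Lemma cderiveZ z f t df : cderive f t df -> cderive (fun u => z * f u) t (z * df).
Proof. by move=> h; have := cderiveM (cderive_cst z t) h; rewrite mul0r add0r. Qed.

Lemma cderive_cexp z (g : R -> R) t dg : is_derive t 1 g dg ->
  cderive (fun u => cexp (z * (g u)%:C%C)) t (z * dg%:C%C * cexp (z * (g t)%:C%C)).
Proof.
move=> h; case: z => a b.
split.
  rewrite [X in is_derive _ _ X](_ : _ = (expR \o (a *: g)) * (cos \o (b *: g))).
    apply: is_derive_eq.
    rewrite /cexp /= /GRing.scale /= !(mulr0,subr0,add0r,addr0).
    ring.
  by apply/funext => u; rewrite /cexp /= !(mulr0,subr0,add0r,addr0).
rewrite [X in is_derive _ _ X](_ : _ = (expR \o (a *: g)) * (sin \o (b *: g))).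
  apply: is_derive_eq.
  rewrite /cexp /= /GRing.scale /= !(mulr0,subr0,add0r,addr0).
  ring.
by apply/funext => u; rewrite /cexp /= !(mulr0,subr0,add0r,addr0).
Qed.

End ComplexPow.

(** * Taylor's inequality *)

Section Taylor.
Variable R : realType.

(** Here [F i] is the i-th derivative of [F 0]. Without the usual 1/K! the induction is one mean
    value step, since the derivative of a remainder of [F 0] is the remainder of [F 1] of one order
    less. *)
Lemma taylor_le (F : nat -> R -> R) (U M : R) (K : nat) :
  (forall i t, 0 <= t <= U -> is_derive t 1 (F i) (F i.+1 t)) ->
  (forall t, 0 <= t <= U -> `|F K t| <= M) ->
  forall t, 0 <= t <= U ->
  `|F 0%N t - \sum_(m < K) F m 0 * t ^+ m / m`!%:R| <= M * t ^+ K.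
Proof.
elim: K F => [|K IH] F dF hM t tU.
  by rewrite big_ord0 subr0 expr0 mulr1; exact: hM.
pose rem u := F 0%N u - \sum_(m < K.+1) F m 0 * u ^+ m / m`!%:R.
pose rem' u := F 1%N u - \sum_(m < K) F m.+1 0 * u ^+ m / m`!%:R.
have drem u : 0 <= u <= U -> is_derive u 1 rem (rem' u).
  move=> uU; have h := dF 0%N u uU; rewrite /rem.
  have -> : (fun u => F 0%N u - \sum_(m < K.+1) F m 0 * u ^+ m / m`!%:R) =
    F 0%N - \sum_(m < K.+1) ((F m 0 / m`!%:R) *: (@idfun R ^+ m)).
    apply/funext => v; rewrite [in RHS]/GRing.add [in RHS]/GRing.opp /=.
    congr (_ - _); rewrite fct_sumE; apply: eq_bigr => m _.
    rewrite !fctE /GRing.scale /=. exact: mulrAC.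
  have h2 (m : 'I_K.+1) : is_derive u 1 ((F m 0 / m`!%:R) *: (@idfun R ^+ m))
    (F m 0 / m`!%:R *: (m%:R * u ^+ m.-1)).
    have := @is_deriveX _ _ (@idfun R) m u 1 1 (is_derive_id _ _).
    move=> h3; apply: is_deriveZ.
    by apply: is_derive_eq h3 _; rewrite /GRing.scale /= mulr1.
  apply: is_derive_eq.
  rewrite /rem'; congr (_ - _).
  rewrite big_ord_recl mul0r scaler0 add0r; apply: eq_bigr => m _ /=.
  rewrite factS natrM /GRing.scale /= invfM.
  have n0 : (m.+1%:R : R) != 0 by rewrite pnatr_eq0.
  have f0 : (m`!%:R : R) != 0 by rewrite pnatr_eq0 -lt0n fact_gt0.
  by rewrite /bump /= add1n; field; rewrite f0 nat1r n0.
have [t0 tU'] : 0 <= t /\ t <= U by apply/andP.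
have rem0 : rem 0 = 0.
  rewrite /rem big_ord_recl expr0 fact0 mulr1 divr1 big1 ?addr0 ?subrr// => m _.
  by rewrite expr0n /= mulr0 mul0r.
have [t00|tpos] := leP t 0.
  have -> : t = 0 by apply/le_anti; rewrite t00.
  by rewrite -/(rem 0) rem0 normr0 expr0n mulr0.
have cont : {within `[0, t], continuous rem}.
  apply: derivable_within_continuous => u; rewrite in_itv /= => /andP[u0 ut].
  by have [] := drem u (ltac:(by rewrite u0 (le_trans ut))).
have [] := @MVT_segment R rem rem' 0 t t0 _ cont.
  move=> u; rewrite in_itv /= => /andP[u0 ut].
  by apply: drem; rewrite (ltW u0) (le_trans (ltW ut)).
move=> c; rewrite in_itv /= => /andP[c0 ct].
rewrite rem0 !subr0 -/(rem t) => ->.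
rewrite normrM (ger0_norm t0) exprSr mulrA ler_wpM2r//.
have cU : 0 <= c <= U by rewrite c0 (le_trans ct).
have := IH (fun i => F i.+1) (fun i => dF i.+1) hM c cU.
move=> /le_trans; apply; rewrite ler_wpM2l ?lerXn2r ?nnegrE//.
by apply: le_trans (normr_ge0 _) (hM c cU).
Qed.

(** The mean value theorem applies to real and imaginary parts separately, whence the factor 2. *)
Lemma ctaylor_le (F : nat -> R -> Cplx R) (U M : R) (K : nat) :
  (forall i t, 0 <= t <= U -> cderive (F i) t (F i.+1 t)) ->
  (forall t, 0 <= t <= U -> normc (F K t) <= M) ->
  forall t, 0 <= t <= U ->
  normc (F 0%N t - \sum_(m < K) F m 0 * (t ^+ m / m`!%:R)%:C%C) <= 2 * M * t ^+ K.
Proof.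
move=> dF hM t tU.
apply: le_trans (normc_leD _) _.
rewrite (raddfB (@complex.Re R)) (raddf_sum (@complex.Re R)).
rewrite (raddfB (@complex.Im R)) (raddf_sum (@complex.Im R)) /=.
rewrite -mulrA mulr_natl mulr2n; apply: lerD.
  rewrite (eq_bigr (fun m : 'I_K => complex.Re (F m 0) * t ^+ m / m`!%:R)); last first.
    by move=> m _; case: (F m 0) => a b /=; rewrite mulr0 subr0 mulrA.
  apply: (@taylor_le (fun i u => complex.Re (F i u)) U M K) => // [i u uU|u uU].
    by have [] := dF i u uU.
  exact: le_trans (normRe_le _) (hM u uU).
rewrite (eq_bigr (fun m : 'I_K => complex.Im (F m 0) * t ^+ m / m`!%:R)); last first.
  by move=> m _; case: (F m 0) => a b /=; rewrite mulr0 add0r mulrA.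
apply: (@taylor_le (fun i u => complex.Im (F i u)) U M K) => // [i u uU|u uU].
  by have [] := dF i u uU.
exact: le_trans (normIm_le _) (hM u uU).
Qed.

End Taylor.

(** * First-order jets with quadratic remainder *)

Section Jets.
Variable R : realType.
Implicit Types (f g : Cplx R -> Cplx R) (s a h : Cplx R) (A B : R).

(* A first-order expansion of f at s0 whose error is quadratic on the unit disc.
   The single constant A bounds everything, so that summing the constants
   justifies differentiating a series term by term. *)
Definition jet s0 f (d : Cplx R) A :=
  [/\ normc (f s0) <= A, normc d <= A &
      forall h, normc h <= 1 ->
        normc (f (s0 + h) - f s0 - h * d) <= A * normc h ^+ 2].

Lemma jet_ge0 s0 f d A : jet s0 f d A -> 0 <= A.
Proof. by case=> h _ _; exact: le_trans (normc_ge0 _) h. Qed.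

Lemma jet_le s0 f d A B : A <= B -> jet s0 f d A -> jet s0 f d B.
Proof.
move=> AB [h1 h2 h3]; split; [exact: le_trans AB|exact: le_trans AB|].
by move=> h hh; apply: le_trans (h3 h hh) _; rewrite ler_wpM2r// exprn_ge0// normc_ge0.
Qed.

Lemma jet_aff s0 c e : jet s0 (fun s => c + e * s) e (normc (c + e * s0) + normc e).
Proof.
split; rewrite ?lerDl ?lerDr ?normc_ge0// => h _.
have -> : c + e * (s0 + h) - (c + e * s0) - h * e = 0 by ring.
by rewrite normc0 mulr_ge0 ?addr_ge0 ?exprn_ge0 ?normc_ge0.
Qed.

Lemma jet_cst s0 c : jet s0 (fun=> c) 0 (normc c).
Proof.
split; rewrite ?normc0 ?normc_ge0// => h _.
have -> : c - c - h * 0 = 0 :> R[i] by ring.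
by rewrite normc0 mulr_ge0 ?exprn_ge0 ?normc_ge0.
Qed.

Lemma jetD s0 f g d e A B : jet s0 f d A -> jet s0 g e B ->
  jet s0 (fun s => f s + g s) (d + e) (A + B).
Proof.
move=> [f1 f2 f3] [g1 g2 g3]; split.
- by apply: le_trans (le_normcD _ _) _; exact: lerD.
- by apply: le_trans (le_normcD _ _) _; exact: lerD.
- move=> h hh; rewrite mulrDl.
  have -> : f (s0 + h) + g (s0 + h) - (f s0 + g s0) - h * (d + e) =
    (f (s0 + h) - f s0 - h * d) + (g (s0 + h) - g s0 - h * e) by ring.
  by apply: le_trans (le_normcD _ _) _; apply: lerD; [exact: f3|exact: g3].
Qed.

(** On the unit disc the value at the centre, the linear term and the error contribute at most A
    each. *)
Lemma jet_bounded s0 f d A h : jet s0 f d A -> normc h <= 1 ->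
  normc (f (s0 + h)) <= 3 * A.
Proof.
move=> J hh; have A0 := jet_ge0 J; case: J => [f1 f2 f3].
have -> : f (s0 + h) = (f (s0 + h) - f s0 - h * d) + (f s0 + h * d) by ring.
have := f3 h hh; have n0 := normc_ge0 h => f3h.
have e1 : A * normc h ^+ 2 <= A by rewrite ler_piMr// expr_le1.
have e2 : normc (h * d) <= A.
  by rewrite normcM; apply: le_trans f2; rewrite ler_piMl// normc_ge0.
have := le_normcD (f (s0 + h) - f s0 - h * d) (f s0 + h * d).
by have := le_normcD (f s0) (h * d); lra.
Qed.

Lemma jetM s0 f g d e A B : jet s0 f d A -> jet s0 g e B ->
  jet s0 (fun s => f s * g s) (d * g s0 + f s0 * e) (6 * (A * B)).
Proof.
move=> Jf Jg; have A0 := jet_ge0 Jf; have B0 := jet_ge0 Jg.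
have AB0 : 0 <= A * B by exact: mulr_ge0.
have gb h : normc h <= 1 -> normc (g (s0 + h)) <= 3 * B.
  by move=> hh; exact: (jet_bounded Jg hh).
case: Jf Jg => [f1 f2 f3] [g1 g2 g3].
have M (u v : R) (x y : R[i]) : normc x <= u -> normc y <= v -> normc (x * y) <= u * v.
  by move=> xa yb; rewrite normcM ler_pM ?normc_ge0.
split.
- by apply: le_trans (M _ _ _ _ f1 g1) _; lra.
- apply: le_trans (le_normcD _ _) _.
  by have := M _ _ _ _ f2 g1; have := M _ _ _ _ f1 g2; lra.
- move=> h hh; have n0 := normc_ge0 h.
  have hM := M _ _ _ _ (f3 h hh) (gb h hh).
  have hN := M _ _ _ _ f1 (g3 h hh).
  have hP := M _ _ _ _ (lexx (normc h)) f2.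
  have hQ : normc (g (s0 + h) - g s0) <= 2 * B * normc h.
    have -> : g (s0 + h) - g s0 = (g (s0 + h) - g s0 - h * e) + h * e by ring.
    apply: le_trans (le_normcD _ _) _.
    have := g3 h hh; have := M _ _ _ _ (lexx (normc h)) g2.
    have : B * normc h ^+ 2 <= B * normc h.
      by rewrite ler_wpM2l// expr2 ler_piMl.
    by lra.
  have hS := M _ _ _ _ hP hQ.
  (* The three products are bounded by 3AB, AB and 2AB times [normc h ^+ 2], whence the constant
     6. *)
  have -> : f (s0 + h) * g (s0 + h) - f s0 * g s0 - h * (d * g s0 + f s0 * e) =
    (f (s0 + h) - f s0 - h * d) * g (s0 + h) +
    (f s0 * (g (s0 + h) - g s0 - h * e) + (h * d) * (g (s0 + h) - g s0)) by ring.
  apply: le_trans (le_normcD _ _) _.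
  have := le_normcD (f s0 * (g (s0 + h) - g s0 - h * e)) ((h * d) * (g (s0 + h) - g s0)).
  by move: hM hN hS; nra.
Qed.

Lemma jetZ s0 f c d A : jet s0 f d A ->
  jet s0 (fun s => c * f s) (c * d) (normc c * A).
Proof.
move=> [f1 f2 f3]; split; rewrite ?normcM ?ler_wpM2l ?normc_ge0// => h hh.
have -> : c * f (s0 + h) - c * f s0 - h * (c * d) = c * (f (s0 + h) - f s0 - h * d) by ring.
by rewrite normcM -mulrA ler_wpM2l ?normc_ge0// f3.
Qed.

Lemma jet_sum s0 (I : Type) (r : seq I) (f : I -> Cplx R -> Cplx R) (d : I -> Cplx R) (A : I -> R) :
  (forall i, jet s0 (f i) (d i) (A i)) ->
  jet s0 (fun s => \sum_(i <- r) f i s) (\sum_(i <- r) d i) (\sum_(i <- r) A i).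
Proof.
move=> J; elim: r => [|i r IH].
  rewrite !big_nil; have -> : (fun s => \sum_(i <- [::]) f i s) = fun=> 0.
    by apply/funext => s; rewrite big_nil.
  by have := jet_cst s0 0; rewrite normc0.
rewrite !big_cons.
have -> : (fun s => \sum_(j <- i :: r) f j s) = (fun s => f i s + \sum_(j <- r) f j s).
  by apply/funext => s; rewrite big_cons.
exact: jetD.
Qed.

Lemma jet_compB s0 c f d A : jet (c - s0) f d A -> jet s0 (fun s => f (c - s)) (- d) A.
Proof.
move=> [f1 f2 f3]; split; rewrite ?normcN// => h hh.
have := f3 (- h); rewrite normcN => /(_ hh).
by rewrite opprD addrA mulrN mulNr.
Qed.

Lemma jet_comp_shift s0 c f d A : jet (s0 + c) f d A -> jet s0 (fun s => f (s + c)) d A.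
Proof. by move=> [f1 f2 f3]; split => // h hh; rewrite (addrAC s0); exact: f3. Qed.

(** This is Taylor's inequality of order 2 for t |-> [cexp] (t z) on [0, 1]. *)
Lemma cexp_second_order (z : Cplx R) :
  normc (cexp z - 1 - z) <= 2 * normc z ^+ 2 * expR (normc z).
Proof.
pose F i t := z ^+ i * cexp (z * t%:C%C).
have -> : cexp z - 1 - z = F 0%N 1 - \sum_(m < 2) F m 0 * (1 ^+ m / m`!%:R)%:C%C.
  rewrite !big_ord_recl big_ord0 /F /= mulr0 cexp0 !expr1n !divr1.
  by rewrite expr0 expr1 !mulr1 !mul1r addr0 opprD addrA.
have -> : 2 * normc z ^+ 2 * expR (normc z) = 2 * (normc z ^+ 2 * expR (normc z)) * 1 ^+ 2.
  by rewrite expr1n; ring.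
apply: (@ctaylor_le R F 1) => //; last by rewrite ler01 lexx.
  move=> i t _; rewrite {2}/F.
  have -> : z ^+ i.+1 * cexp (z * t%:C%C) = z ^+ i * (z * 1%:C%C * cexp (z * t%:C%C)).
    by rewrite exprSr mulr1 mulrA.
  by apply: cderiveZ; apply: cderive_cexp; exact: is_derive_id.
move=> t /andP[t0 t1]; rewrite normcM normcX ler_wpM2l ?exprn_ge0 ?normc_ge0//.
rewrite normc_cexp ler_expR; apply: le_trans (ler_norm _) _.
apply: le_trans (normRe_le _) _; rewrite normcM normcR ger0_norm//.
by rewrite ler_piMr// normc_ge0.
Qed.

(** The error is governed by (ln x)^2 x^|h| <= x^3 for |h| <= 1. The constant thus remains a power
    of x, three degrees above the size of x^s0; a higher order K makes up for this loss. *)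
Lemma jet_cpow s0 (x : R) : 1 <= x ->
  jet s0 (cpow x) ((ln x)%:C%C * cpow x s0)
    (2 * expR ((complex.Re s0 + 3) * ln x)).
Proof.
move=> x1; have x0 : 0 < x by exact: lt_le_trans x1.
have l0 : 0 <= ln x by exact: ln_ge0.
have lx : ln x <= x by have := @le_ln1Dx R (x - 1); rewrite (_ : 1 + (x - 1) = x); [lra|ring].
have -> : 2 * expR ((complex.Re s0 + 3) * ln x) = 2 * (normc (cpow x s0) * x ^+ 3).
  by rewrite normc_cpow (mulrDl (complex.Re s0)) expRD [3 * _]mulrC expRM_natr lnK.
set X := normc (cpow x s0); have X0 : 0 <= X by exact: normc_ge0.
have x2 : 1 <= x ^+ 2 by rewrite expr_ge1 // ltW.
have x3 : x <= x ^+ 3 by rewrite exprS ler_pMr.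
split.
- by rewrite -/X; nra.
- by rewrite normcM normcR ger0_norm// -/X; nra.
- move=> h hh; have n0 := normc_ge0 h.
  have -> : cpow x (s0 + h) - cpow x s0 - h * ((ln x)%:C%C * cpow x s0) =
    cpow x s0 * (cexp (h * (ln x)%:C%C) - 1 - h * (ln x)%:C%C).
    by rewrite cpowD /cpow; ring.
  rewrite normcM -/X.
  have -> : 2 * (X * x ^+ 3) * normc h ^+ 2 = X * (2 * x ^+ 3 * normc h ^+ 2) by ring.
  rewrite ler_wpM2l//.
  apply: le_trans (cexp_second_order _) _.
  rewrite normcM normcR ger0_norm// exprMn.
  have e1 : expR (normc h * ln x) <= x.
    by rewrite -[leRHS](lnK (x0 : x \in Num.pos)) ler_expR ler_piMl.
  have e2 : ln x ^+ 2 <= x ^+ 2 by rewrite lerXn2r// nnegrE ltW.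
  have e3 : ln x ^+ 2 * expR (normc h * ln x) <= x ^+ 3.
    by rewrite [leRHS]exprSr ler_pM ?expR_ge0 ?exprn_ge0.
  have : normc h ^+ 2 * (ln x ^+ 2 * expR (normc h * ln x)) <= normc h ^+ 2 * x ^+ 3.
    by rewrite ler_wpM2l ?exprn_ge0.
  by lra.
Qed.

Lemma jet_taylor a0 (F : nat -> R -> Cplx R -> Cplx R) (D : nat -> R -> Cplx R)
   (U M : R) (K : nat) :
  (forall i t a, 0 <= t <= U -> cderive (fun u => F i u a) t (F i.+1 t a)) ->
  (forall i t, 0 <= t <= U -> cderive (D i) t (D i.+1 t)) ->
  (forall t, 0 <= t <= U -> jet a0 (F K t) (D K t) M) ->
  forall t, 0 <= t <= U ->
  jet a0 (fun a => F 0%N t a - \sum_(m < K) F m 0 a * (t ^+ m / m`!%:R)%:C%C)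
    (D 0%N t - \sum_(m < K) D m 0 * (t ^+ m / m`!%:R)%:C%C) (2 * M * t ^+ K).
Proof.
move=> dF dD J t tU; split.
- apply: (@ctaylor_le R (fun i u => F i u a0) U) => // [i u uU|u uU]; first exact: dF.
  by have [] := J u uU.
- apply: (@ctaylor_le R D U) => // u uU.
  by have [] := J u uU.
- move=> h hh.
  (* For fixed h, the errors of the jets of the [F i] form again a chain of successive derivatives
     in t, to which Taylor's inequality applies. *)
  pose E i u := F i u (a0 + h) + (-1) * F i u a0 + (- h) * D i u.
  have := @ctaylor_le R E U (M * normc h ^+ 2) K _ _ t tU.
  rewrite [leRHS](_ : _ = 2 * M * t ^+ K * normc h ^+ 2); last by ring.
  have -> : E 0%N t - \sum_(m < K) E m 0 * (t ^+ m / m`!%:R)%:C%C =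
    (F 0%N t (a0 + h) - \sum_(m < K) F m 0 (a0 + h) * (t ^+ m / m`!%:R)%:C%C -
   (F 0%N t a0 - \sum_(m < K) F m 0 a0 * (t ^+ m / m`!%:R)%:C%C) -
   h * (D 0%N t - \sum_(m < K) D m 0 * (t ^+ m / m`!%:R)%:C%C)).
    have -> : \sum_(m < K) E m 0 * (t ^+ m / m`!%:R)%:C%C =
      \sum_(m < K) F m 0 (a0 + h) * (t ^+ m / m`!%:R)%:C%C -
      \sum_(m < K) F m 0 a0 * (t ^+ m / m`!%:R)%:C%C -
      h * \sum_(m < K) D m 0 * (t ^+ m / m`!%:R)%:C%C.
      rewrite mulr_sumr -!sumrB; apply: eq_bigr => m _; rewrite /E; ring.
    by rewrite /E; ring.
  apply.
    move=> i u uU; apply: cderiveD; last by apply: cderiveZ; exact: dD.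
    by apply: cderiveD; [exact: dF|apply: cderiveZ; exact: dF].
  move=> u uU; have [_ _ /(_ h hh)] := J u uU.
  by rewrite /E mulN1r mulNr.
Qed.

End Jets.

(** * Termwise differentiation of series *)

Section JetSeries.
Variable R : realType.
Implicit Types (f g : Cplx R -> Cplx R) (s a h : Cplx R) (A B : R).

Lemma jet_cvg s0 (f : nat -> Cplx R -> Cplx R) (d : nat -> Cplx R) (A : nat -> R) h :
  (forall n, jet s0 (f n) (d n) (A n)) -> cvgn (series A) -> normc h <= 1 ->
  cvgn (series (fun n => f n (s0 + h))).
Proof.
move=> J cA hh; apply: cvg_series_normc.
apply: (@series_le_cvg _ _ (fun n => 3 * A n)).
- by move=> n; exact: normc_ge0.
- by move=> n; rewrite mulr_ge0// (jet_ge0 (J n)).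
- by move=> n; exact: jet_bounded (J n) hh.
- exact: is_cvg_seriesZ.
Qed.

(** As [A n] dominates value, derivative and error at once, the three series converge and the three
    inequalities pass to the limit. This stands in for Weierstrass's theorem on limits of
    holomorphic functions. *)
Lemma jet_series s0 (f : nat -> Cplx R -> Cplx R) (d : nat -> Cplx R) (A : nat -> R) :
  (forall n, jet s0 (f n) (d n) (A n)) -> cvgn (series A) ->
  jet s0 (fun s => limn (series (fun n => f n s))) (limn (series d)) (limn (series A)).
Proof.
move=> J cA; split.
- by apply: normc_series_le => // n; case: (J n).
- by apply: normc_series_le => // n; case: (J n).
- move=> h hh.
  have c1 := jet_cvg J cA hh.
  have c2 : cvgn (series (fun n => f n s0)).
    by have := @jet_cvg s0 f d A 0 J cA; rewrite addr0; apply; rewrite normc0.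
  have c3 : cvgn (series d).
    apply: cvg_series_normc; apply: series_le_cvg cA.
    + by move=> n; exact: normc_ge0.
    + by move=> n; exact: jet_ge0 (J n).
    + by move=> n; case: (J n).
  pose u n := f n (s0 + h) - f n s0 - h * d n.
  have cu : series u @ \oo --> limn (series (fun n => f n (s0 + h))) -
    limn (series (fun n => f n s0)) - h * limn (series d).
    have -> : series u = series (fun n => f n (s0 + h)) - series (fun n => f n s0)
      - (h *: series d).
      apply/funext => n; rewrite /series /u !fctE /= !sumrB; congr (_ - _).
      by rewrite -mulr_sumr.
    exact: (cvgB (cvgB c1 c2) (@cvgZl_tmp R[i] (Cplx R) nat \oo _ h _ _ c3)).
  rewrite -(cvg_lim _ cu)//.
  apply: le_trans (normc_series_le (A := fun n => normc h ^+ 2 * A n) _ _) _.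
  + by move=> n; have [_ _ /(_ h hh)] := J n; rewrite (mulrC (_ ^+ 2)).
  + exact: is_cvg_seriesZ.
  + by rewrite lim_seriesZ// [leRHS]mulrC.
Qed.

Lemma jet_differentiable s0 f d A : jet s0 f d A -> differentiable f s0.
Proof.
move=> J; have A0 := jet_ge0 J; case: J => _ _ f3.
apply/derivable1_diffP; apply/cvg_ex; exists d; apply/cvg_normcP => e e0.
have hlt (k : R) : 0 < k -> \forall h \near (0 : Cplx R)^', normc h < k.
  move=> k0; have : \forall h \near (0 : Cplx R)^', `|h| < (k%:C%C : R[i]).
    by apply: dnbhs0_lt; rewrite ltcR.
  by apply: filterS => x; rewrite normrE ltcR.
near=> h.
have h0 : h != 0 by near: h; exact: nbhs_dnbhs_neq.
have h1 : normc h < 1 by near: h; exact: hlt.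
(* The quotient differs from d by at most A |h|; dividing by A + 1 also covers A = 0. *)
have h2 : normc h < e / (A + 1) by near: h; apply: hlt; rewrite divr_gt0//; lra.
have n0 : 0 < normc h by rewrite lt_neqAle normc_ge0 eq_sym normc_eq0 h0.
have -> : d - h^-1 *: (f (h *: 1 + s0) - f s0) = - h^-1 * (f (s0 + h) - f s0 - h * d).
  by rewrite /GRing.scale /= mulr1 (addrC h); field.
rewrite normcM normcN normcV mulrC ltr_pdivrMr//.
apply: le_lt_trans (f3 h (ltW h1)) _.
move: h2; rewrite ltr_pdivlMr; last by lra.
by move=> h2; nra.
Unshelve. all: by end_near. Qed.

End JetSeries.

(** * Taylor expansion of x^a, uniformly in the exponent *)

Section PowerTaylor.
Variable R : realType.
Implicit Types (a : Cplx R).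

(** The falling factorial, so that the i-th derivative of x^a in x is [ffactc a i] x^(a - i). *)
Definition ffactc a (i : nat) : Cplx R := \prod_(k < i) (a - k%:R).

(** The derivative of [ffactc] in a, unfolded by the product rule. *)
Fixpoint dffactc a (i : nat) : Cplx R :=
  if i is j.+1 then dffactc a j * (a - j%:R) + ffactc a j else 0.

Lemma ffactcS a i : ffactc a i.+1 = ffactc a i * (a - i%:R).
Proof. by rewrite /ffactc big_ord_recr. Qed.

Lemma jet_ffactc a0 i : exists A, jet a0 (fun a => ffactc a i) (dffactc a0 i) A.
Proof.
elim: i => [|i [A IH]].
  exists (normc (1 : Cplx R)); rewrite /ffactc /=.
  have -> : (fun a => \prod_(k < 0) (a - k%:R)) = fun=> 1.
    by apply/funext => a; rewrite big_ord0.
  exact: jet_cst.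
have J := jetM IH (jet_aff a0 (- i%:R) 1).
eexists; rewrite /=.
have -> : (fun a => ffactc a i.+1) = (fun a => ffactc a i * (- i%:R + 1 * a)).
  by apply/funext => a; rewrite ffactcS mul1r (addrC a).
by rewrite mul1r mulr1 (addrC _ a0) in J; exact: J.
Qed.

Definition taylor_rem (K : nat) (x t : R) a : Cplx R :=
  cpow (x + t) a -
  \sum_(m < K) ffactc a m * cpow x (a - m%:R) * (t ^+ m / m`!%:R)%:C%C.

(* Taylor's inequality in t applies to the value, the derivative and the error
   term of the jet in a simultaneously, since all three commute with d/dt. *)
Lemma jet_taylor_rem a0 (K : nat) (U : R) : complex.Re a0 + 5 <= K%:R ->
  exists2 C, 0 <= C & forall x t, 1 <= x -> 0 <= t <= U ->
    exists d, jet a0 (taylor_rem K x t) d (C / x ^+ 2).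
Proof.
move=> aK; have [A JA] := jet_ffactc a0 K; have A0 := jet_ge0 JA.
have [U0|U0] := ltP U 0.
  by exists 0 => // x t _ /andP[t0 tU]; have := le_trans t0 tU; rewrite leNgt U0.
exists (2 * (6 * (A * 2)) * U ^+ K) => [|x t x1 /[dup] tU /andP[t0 tU1]].
  by rewrite !mulr_ge0 ?exprn_ge0.
have x0 : 0 < x by exact: lt_le_trans x1.
(* [F i] is the i-th derivative of (x + u)^a in u, and [D i] the derivative of [F i] in a at
   [a0]. *)
pose F i u a := ffactc a i * cpow (x + u) (a - i%:R).
pose D i u := dffactc a0 i * cpow (x + u) (a0 - i%:R) +
  ffactc a0 i * ((ln (x + u))%:C%C * cpow (x + u) (a0 - i%:R)).
have ps u : 0 <= u -> 0 < x + u by move=> u0; rewrite ltr_wpDr.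
have dlnx (u : R) : 0 <= u -> is_derive u 1 (fun u => ln (x + u)) (x + u)^-1.
  move=> u0; have dx : is_derive u 1 (fun u => x + u) 1.
    have -> : (fun u => x + u) = cst x + id by apply/funext.
    by apply: is_derive_eq; rewrite add0r.
  have /is_derive1_ln dl := ps u u0.
  apply: is_derive_eq (is_derive1_comp dl dx) _.
  by rewrite /GRing.scale /= mulr1.
have dpow u z : 0 <= u -> cderive (fun u => cpow (x + u) z) u (z * cpow (x + u) (z - 1)).
  move=> u0; have := cderive_cexp z (dlnx u u0); rewrite -mulrA; congr (cderive _ _ (_ * _)).
  rewrite -[X in cexp (X * _)](subrK 1) -/(cpow _ _) cpowS ?ps// mulrC -mulrA.
  by rewrite -rmorphM mulfV ?gt_eqF ?ps// mulr1.
have dln u : 0 <= u -> cderive (fun u => (ln (x + u))%:C%C) u ((x + u)^-1)%:C%C.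
  by move=> u0; apply: cderive_real; exact: dlnx.
have M0 : 0 <= 6 * (A * 2) by rewrite !mulr_ge0.
have x20 : 0 < x ^+ 2 by rewrite exprn_gt0.
have := @jet_taylor R a0 F D U (6 * (A * 2) / x ^+ 2) K _ _ _ t tU.
have -> : taylor_rem K x t =
    (fun a => F 0%N t a - \sum_(m < K) F m 0 a * (t ^+ m / m`!%:R)%:C%C).
  apply/funext => a; rewrite /taylor_rem /F /ffactc big_ord0 mul1r subr0.
  by congr (_ - _); apply: eq_bigr => m _; rewrite addr0.
move=> J; eexists; apply: (jet_le _ (J _ _ _)).
- have -> : 2 * (6 * (A * 2)) * U ^+ K / x ^+ 2 = 2 * (6 * (A * 2) / x ^+ 2) * U ^+ K.
    by ring.
  apply: ler_wpM2l; first by rewrite mulr_ge0// divr_ge0// ltW.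
  by rewrite lerXn2r// nnegrE (le_trans t0).
- move=> i u a /andP[u0 uU]; rewrite /F ffactcS -mulrA.
  apply: cderiveZ; have := dpow u (a - i%:R) u0.
  by rewrite -addrA -opprD natr1.
- move=> i u /andP[u0 uU]; rewrite /D /=.
  have -> : a0 - i.+1%:R = a0 - i%:R - 1 by rewrite -natr1 opprD addrA.
  have := cderiveD (cderiveZ (dffactc a0 i) (dpow u (a0 - i%:R) u0))
   (cderiveZ (ffactc a0 i) (cderiveM (dln u u0) (dpow u (a0 - i%:R) u0))).
  congr (cderive _ _ _); rewrite ffactcS.
  have -> : cpow (x + u) (a0 - i%:R) = cpow (x + u) (a0 - i%:R - 1) * (x + u)%:C%C.
    by rewrite -cpowS ?ps// subrK.
  have e : ((x + u)^-1)%:C%C * (x + u)%:C%C = 1 :> R[i].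
    by rewrite -rmorphM mulVf ?gt_eqF ?ps.
  have -> : ((x + u)^-1)%:C%C * (cpow (x + u) (a0 - i%:R - 1) * (x + u)%:C%C) =
    cpow (x + u) (a0 - i%:R - 1) by rewrite mulrCA e mulr1.
  ring.
- move=> u /andP[u0 uU].
  have xu1 : 1 <= x + u by lra.
  have J2 := jet_comp_shift (jet_cpow (a0 + - K%:R) xu1).
  apply: (jet_le _ (jetM JA J2)).
  rewrite -mulrA ler_wpM2l// -mulrA ler_wpM2l// ler_wpM2l//.
  rewrite (raddfD (@complex.Re R)) (raddfN (@complex.Re R)) /=.
  have -> : complex.Re (K%:R : R[i]) = K%:R.
    by have -> : (K%:R : R[i]) = (K%:R)%:C%C by rewrite rmorph_nat.
  have l0 : 0 <= ln x by exact: ln_ge0.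
  have l1 : ln x <= ln (x + u) by rewrite ler_ln ?posrE ?ps//; lra.
  have -> : (x ^+ 2)^-1 = expR (- (ln x *+ 2)).
    by rewrite expRN -mulr_natl expRM_natl lnK.
  (* By [aK] the exponent satisfies Re a0 - K + 3 <= -2: the 5 assumed there is the loss of 3 in
     [jet_cpow] plus the 2 wanted in C / x^2. *)
  by rewrite ler_expR mulr2n; nra.
Qed.

End PowerTaylor.

(** * Shift operators and numerical differentiation *)

Section RiemannSeries.
Variable R : realType.

(** The comparison of x^(-p) with its integral, derived from 1 / (x + 1) <= ln (x + 1) - ln x and 1
    + u <= exp u. *)
Lemma powR_telescope_le (p x : R) : 1 < p -> 0 < x ->
  (p - 1) * (x + 1) `^ (- p) <= x `^ (1 - p) - (x + 1) `^ (1 - p).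
Proof.
move=> p1 x0; have y0 : 0 < x + 1 by lra.
have hl : (x + 1)^-1 <= ln (x + 1) - ln x.
  rewrite -ln_div ?posrE// -[(x + 1) / x]invrK lnV ?posrE ?invr_gt0 ?divr_gt0// invf_div.
  have -> : x / (x + 1) = 1 + - (x + 1)^-1 by field; rewrite gt_eqF.
  have := @le_ln1Dx R (- (x + 1)^-1); rewrite ltrN2 invf_lt1// ltrDr => /(_ x0).
  by lra.
have e1 : (x + 1) `^ (- p) = (x + 1) `^ (1 - p) * (x + 1)^-1.
  by rewrite -powR_inv1 ?ltW// -powRD; [congr (_ `^ _); ring|rewrite (gt_eqF y0) implybT].
have e2 : x `^ (1 - p) = (x + 1) `^ (1 - p) * expR ((p - 1) * (ln (x + 1) - ln x)).
  by rewrite /powR !gt_eqF// -expRD; congr expR; ring.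
rewrite e1 e2; have Y0 : 0 <= (x + 1) `^ (1 - p) by exact: powR_ge0.
have := expR_ge1Dx ((p - 1) * (ln (x + 1) - ln x)).
have : (p - 1) * (x + 1)^-1 <= (p - 1) * (ln (x + 1) - ln x) by rewrite ler_wpM2l//; lra.
by move=> h1 h2; nra.
Qed.

Lemma cvg_series_powR (p : R) : 1 < p ->
  cvgn (series (fun n => n.+1%:R `^ (- p))).
Proof.
move=> p1; apply: nondecreasing_is_cvgn.
  by apply: nondecreasing_series => n _ _; exact: powR_ge0.
have p0 : 0 < p - 1 by lra.
(* The constant p turns the case of a single term into an equality; afterwards the bounds
   telescope. *)
have bd N : (p - 1) * (\sum_(0 <= n < N.+1) n.+1%:R `^ (- p)) <= p - N.+1%:R `^ (1 - p).
  elim: N => [|N IH].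
    by rewrite big_nat1 !powR1 mulr1.
  rewrite big_nat_recr//= mulrDr.
  have := @powR_telescope_le p N.+1%:R p1 (ltr0Sn _ _); rewrite natr1.
  by lra.
exists (p / (p - 1)) => _ [N _ <-].
rewrite ler_pdivlMr// mulrC; case: N => [|N].
  by rewrite /series /= big_geq// mulr0; lra.
by apply: le_trans (bd N) _; rewrite gerBl powR_ge0.
Qed.

End RiemannSeries.

Section ShiftOperators.
Variable K : comNzRingType.
Variable T : nzRingType.
Implicit Types (p q : {poly K}) (g : T -> K) (x : T).

(* [shiftop p] is p(E), for E the shift of step 1. *)
Definition shiftop p g x := \sum_(j < size p) p`_j * g (x + j%:R).

Lemma shiftopE n p g x : (size p <= n)%N ->
  shiftop p g x = \sum_(j < n) p`_j * g (x + j%:R).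
Proof.
move=> pn; rewrite /shiftop (big_ord_widen n (fun j => p`_j * g (x + j%:R)))//.
rewrite big_mkcond /=; apply: eq_bigr => j _.
by case: ltnP => // h; rewrite nth_default// mul0r.
Qed.

Lemma shiftopD p q g x : shiftop (p + q) g x = shiftop p g x + shiftop q g x.
Proof.
rewrite (@shiftopE _ _ g x (size_polyD p q)) (@shiftopE _ p g x (leq_maxl _ (size q))).
rewrite (@shiftopE _ q g x (leq_maxr (size p) _)) -big_split; apply: eq_bigr => j _.
by rewrite coefD mulrDl.
Qed.

Lemma shiftopZ c p g x : shiftop (c *: p) g x = c * shiftop p g x.
Proof.
rewrite (@shiftopE _ _ g x (size_scale_leq c p)) /shiftop mulr_sumr.
by apply: eq_bigr => j _; rewrite coefZ mulrA.
Qed.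

Lemma shiftopB p q g x : shiftop (p - q) g x = shiftop p g x - shiftop q g x.
Proof. by rewrite -scaleN1r shiftopD shiftopZ mulN1r. Qed.

Lemma shiftopX p g x : shiftop ('X * p) g x = shiftop p g (x + 1).
Proof.
rewrite (@shiftopE (size p).+1); last first.
  by apply: leq_trans (size_polyMleq _ _) _; rewrite size_polyX.
rewrite big_ord_recl coefXM /= mul0r add0r; apply: eq_bigr => j _.
by rewrite coefXM /= /bump /= add1n -addrA nat1r.
Qed.

Lemma shiftop_diff p g x : shiftop (('X - 1) * p) g x = shiftop p g (x + 1) - shiftop p g x.
Proof. by rewrite mulrBl mul1r shiftopB shiftopX. Qed.

Lemma sum_shiftop_diff p g x N :
  \sum_(0 <= n < N) shiftop (('X - 1) * p) g (x + n%:R) =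
  shiftop p g (x + N%:R) - shiftop p g x.
Proof.
elim: N => [|N IH]; first by rewrite big_geq// addr0 subrr.
rewrite big_nat_recr//= IH shiftop_diff -(natr1 N) (addrA x); ring.
Qed.

End ShiftOperators.

(** * Moments of the coefficients of a polynomial *)

Section Moments.
Variable K : comNzRingType.
Implicit Types (p q : {poly K}).

(** The Euler operator X d/dX multiplies the coefficient of X^j by j, so its iterates turn moments
    of the coefficients into values at 1. *)
Definition euler_op p := 'X * p^`().

Lemma coef_iter_euler m p j : (iter m euler_op p)`_j = p`_j * j%:R ^+ m.
Proof.
elim: m => [|m IH]; first by rewrite expr0 mulr1.
rewrite iterS /euler_op coefXM; case: j IH => [|j] IH; first by rewrite expr0n mulr0.
by rewrite /= coef_deriv IH exprSr mulrA mulr_natr.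
Qed.

Lemma momentE n p m : (size p <= n)%N ->
  \sum_(j < n) p`_j * j%:R ^+ m = (iter m euler_op p).[1].
Proof.
move=> pn; rewrite (@horner_coef_wide _ n).
  by apply: eq_bigr => j _; rewrite coef_iter_euler expr1n mulr1.
apply/leq_sizeP => j nj; rewrite coef_iter_euler nth_default ?mul0r//.
exact: leq_trans nj.
Qed.

(** Each application of X d/dX costs at most one factor 1 - X. Fewer than k applications therefore
    leave a polynomial vanishing at 1. *)
Lemma iter_euler_X1n k r m : (m <= k)%N ->
  exists r', iter m euler_op ((1 - 'X) ^+ k * r) = (1 - 'X) ^+ (k - m) * r'.
Proof.
elim: m => [|m IH] mk; first by exists r; rewrite subn0.
have [r' e] := IH (ltnW mk); rewrite iterS e.
have -> : (k - m = (k - m.+1).+1)%N by rewrite subnSK.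
set i := (k - m.+1)%N.
exists ('X * (- (r' *+ i.+1) + (1 - 'X) * r'^`())).
rewrite /euler_op derivM deriv_exp derivB derivC derivX sub0r exprS /= -mulr_natr.
rewrite -(mulr_natr r'); ring.
Qed.

End Moments.

Section NumericalDerivative.
Variable K : numFieldType.

(* With D = log(1 + (E - 1)), [alphaP n] is the truncation of D at order n. *)
Definition betaP (n : nat) : {poly K} :=
  \sum_(k < n) ((-1) ^+ k / k.+1%:R) *: ('X - 1) ^+ k.
Definition alphaP (n : nat) : {poly K} := ('X - 1) * betaP n.

Lemma size_alphaP n : (size (alphaP n) <= n.+1)%N.
Proof.
have sX : size ('X - 1 : {poly K}) = 2%N by exact: size_XsubC.
apply: leq_trans (size_polyMleq _ _) _; rewrite sX /= ltnS.
apply: leq_trans (size_sum _ _ _) _; apply/bigmax_leqP => k _.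
apply: leq_trans (size_scale_leq _ _) _.
apply: leq_trans (size_poly_exp_leq _ _) _; rewrite sX mul1n; exact: ltn_ord.
Qed.

Lemma alphaPS n :
  alphaP n.+1 = alphaP n + ((-1) ^+ n / n.+1%:R) *: ('X - 1) ^+ n.+1.
Proof.
by rewrite /alphaP /betaP big_ord_recr /= mulrDr -scalerAr -exprS.
Qed.

(** The derivative of the truncated logarithm is the geometric sum of the (1 - X)^k for k < n, which
    X = 1 - (1 - X) telescopes. *)
Lemma euler_alphaP n : euler_op (alphaP n) = 1 - (1 - 'X) ^+ n.
Proof.
elim: n => [|n IH].
  by rewrite /euler_op /alphaP /betaP big_ord0 mulr0 derivC mulr0 expr0 subrr.
have key : ((-1) ^+ n / n.+1%:R) *: (('X - 1) ^+ n *+ n.+1) = (1 - 'X) ^+ n :> {poly K}.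
  rewrite -(scaler_nat _ (('X - 1) ^+ n)) scalerA divfK ?pnatr_eq0//.
  by rewrite -exprZn scaleN1r opprB.
rewrite alphaPS /euler_op derivD mulrDr -/(euler_op _) IH derivZ deriv_exp.
by rewrite derivB derivX derivC subr0 mul1r /= key exprS; ring.
Qed.

(** These are the moments of d/dx at 0: [alphaP n] differentiates polynomials of degree at most n
    exactly. For m = 0 the factor X - 1 vanishes at 1. For m >= 1, [euler_alphaP] leaves a constant,
    which survives only if m = 1, and (1 - X)^n, which keeps a factor 1 - X after m - 1 < n
    steps. *)
Lemma moment_alphaP n m : (m <= n)%N -> (0 < n)%N ->
  \sum_(j < n.+1) (alphaP n)`_j * j%:R ^+ m = (m == 1)%:R.
Proof.
move=> mn n0; rewrite (momentE _ (size_alphaP n)).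
case: m mn => [|m] mn; first by rewrite /= /alphaP hornerM !hornerE subrr mul0r.
rewrite iterSr euler_alphaP.
have iterB p q : iter m (@euler_op K) (p - q) = iter m (@euler_op K) p - iter m (@euler_op K) q.
  by elim: m {mn} => //= m ->; rewrite /euler_op derivB mulrBr.
rewrite iterB hornerD hornerN -[_ ^+ n]mulr1.
have [r ->] := @iter_euler_X1n K n 1 m (ltnW mn).
rewrite hornerM horner_exp !hornerE subrr expr0n subn_eq0 leqNgt mn mul0r subr0.
case: m {mn iterB} => [|m]; first by rewrite /= hornerC.
rewrite iterSr {2}/euler_op derivC mulr0.
suff -> : iter m (@euler_op K) 0 = 0 by rewrite horner0.
by elim: m => //= m ->; rewrite /euler_op linear0 mulr0.
Qed.

End NumericalDerivative.

(** * Continuation of the Hurwitz series *)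

Section HurwitzContinuation.
Variables (R : realType).
Implicit Types (s : Cplx R) (x : R) (K : nat).

Definition pow1 s (x : R) : Cplx R := cpow x (1 - s).

(* The error of numerical differentiation of x ^ (1 - s) at order K; it decays
   fast enough in x to be summable as soon as K is large with respect to - Re s. *)
Definition diff_error K s x : Cplx R :=
  (1 - s) * cpow x (- s) - shiftop (alphaP _ K) (pow1 s) x.

(** By the moments of [alphaP] every Taylor term of x^(1 - s) cancels but the one of degree 1, which
    is (1 - s) x^(-s). Only the remainders are left. *)
Lemma diff_error_taylor K s x : (0 < K)%N ->
  diff_error K s x =
  - \sum_(j < K.+1) (alphaP R[i] K)`_j * taylor_rem K.+1 x j%:R (1 - s).
Proof.
move=> K0; rewrite /diff_error (@shiftopE _ _ K.+1) ?size_alphaP// /taylor_rem.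
under [in RHS]eq_bigr => j _ do rewrite mulrBr.
rewrite sumrB opprB; congr (_ - _).
under eq_bigr => j _ do rewrite mulr_sumr.
rewrite exchange_big /=.
under eq_bigr => m _.
  rewrite (eq_bigr (fun j : 'I_K.+1 =>
    (ffactc (1 - s) m * cpow x (1 - s - m%:R) * (m`!%:R)^-1) *
    ((alphaP R[i] K)`_j * j%:R ^+ m))).
    rewrite -mulr_sumr moment_alphaP//; last by rewrite -ltnS.
    over.
  move=> j _; rewrite rmorphM rmorphXn fmorphV !rmorph_nat; ring.
rewrite (bigD1 (Ordinal (K0 : (1 < K.+1)%N)))//= big1 ?addr0.
  rewrite (_ : (1`!)%N = 1%N)// invr1 !mulr1 /ffactc big_ord_recl big_ord0 mulr1 subr0.
  by congr (_ * cpow _ _); ring.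
move=> m m1; rewrite (_ : (m == 1%N :> nat) = false) ?mulr0//.
by apply: contraNF m1 => /eqP e; apply/eqP/val_inj.
Qed.

Lemma jet_diff_error K s0 : (0 < K)%N -> complex.Re (1 - s0) + 5 <= K.+1%:R ->
  exists2 C, 0 <= C & forall x, 1 <= x ->
    exists d, jet s0 (fun s => diff_error K s x) d (C / x ^+ 2).
Proof.
(* The shifts j occurring in [alphaP K] are at most K, so the Taylor estimate is needed on
   [0, K]. *)
move=> K0 sK; have [C C0 hC] := @jet_taylor_rem R (1 - s0) K.+1 K%:R sK.
exists (\sum_(j < K.+1) normc (alphaP R[i] K)`_j * C).
  by apply: sumr_ge0 => j _; rewrite mulr_ge0// normc_ge0.
move=> x x1.
have hj (j : 'I_K.+1) : exists d, jet s0 (fun s => (- (alphaP R[i] K)`_j) * taylor_rem K.+1 x j%:R (1 - s)) d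
   (normc (alphaP R[i] K)`_j * C / x ^+ 2).
  have [|d J] := hC x j%:R x1; first by rewrite ler0n ler_nat /= leq_ord.
  by eexists; rewrite -mulrA -normcN; apply: jetZ; apply: jet_compB; exact: J.
have /choice[d hd] := hj.
eexists; have := jet_sum (index_enum _) hd; rewrite mulr_suml; congr (jet _ _ _ _).
apply/funext => s; rewrite diff_error_taylor// -sumrN; apply: eq_bigr => j _.
by rewrite mulNr.
Qed.

Variable q : R.
Hypothesis q1 : 1 <= q.

Lemma qn_ge1 (n : nat) : 1 <= q + n%:R.
Proof. by rewrite (le_trans q1)// lerDl. Qed.

Lemma cvg_series_inv_sqr C : 0 <= C ->
  cvgn (series (fun n : nat => C / (q + n%:R) ^+ 2)).
Proof.
move=> C0; apply: is_cvg_seriesZ.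
apply: (series_le_cvg (v_ := fun n => n.+1%:R `^ (- 2))).
- by move=> n; rewrite invr_ge0 exprn_ge0// addr_ge0// (le_trans _ q1).
- by move=> n; exact: powR_ge0.
- move=> n; rewrite powRN powR_mulrn//.
  have n0 : 0 < q + n%:R := lt_le_trans ltr01 (qn_ge1 n).
  rewrite lef_pV2 ?posrE ?exprn_gt0// lerXn2r ?nnegrE ?(ltW n0)//.
  by rewrite -natr1 addrC lerD2r.
- by apply: cvg_series_powR; lra.
Qed.

(* Summing [diff_error] telescopes, so this is (1 - s) zeta(s, q) for 1 < Re s; the
   series still converges for K large with respect to - Re s. *)
Definition hurwitz_cont K s : Cplx R :=
  limn (series (fun n : nat => diff_error K s (q + n%:R) : Cplx R)) +
  - shiftop (betaP _ K) (pow1 s) q.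

Lemma jet_diff_error_seq K s0 : (0 < K)%N -> complex.Re (1 - s0) + 5 <= K.+1%:R ->
  exists (d : nat -> Cplx R) (A : nat -> R), cvgn (series A) /\
    forall n, jet s0 (fun s => diff_error K s (q + n%:R)) (d n) (A n).
Proof.
move=> K0 sK; have [C C0 hC] := jet_diff_error K0 sK.
have /choice[d hd] := fun n => hC _ (qn_ge1 n).
by exists d, (fun n => C / (q + n%:R) ^+ 2); split => //; exact: cvg_series_inv_sqr.
Qed.

Lemma cvg_diff_error K s : (0 < K)%N -> complex.Re (1 - s) + 5 <= K.+1%:R ->
  cvgn (series (fun n : nat => diff_error K s (q + n%:R) : Cplx R)).
Proof.
move=> K0 sK; have [d [A [cA J]]] := jet_diff_error_seq K0 sK.
have := @jet_cvg R s _ d A 0 J cA; rewrite addr0; apply.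
by rewrite normc0.
Qed.

Lemma jet_hurwitz_cont K s0 : (0 < K)%N -> complex.Re (1 - s0) + 5 <= K.+1%:R ->
  exists d A, jet s0 (hurwitz_cont K) d A.
Proof.
move=> K0 sK; have [d [A [cA J]]] := jet_diff_error_seq K0 sK.
have hj (j : nat) : exists (dA : Cplx R * R), jet s0
    (fun s => (- (betaP R[i] K)`_j) * pow1 s (q + j%:R)) dA.1 dA.2.
  by eexists (_, _); apply: jetZ; apply: jet_compB; exact: jet_cpow (qn_ge1 j).
have /choice[d' hd] := hj.
do 2!eexists; apply: jetD; first exact: jet_series J cA.
have -> : (fun s => - shiftop (betaP _ K) (pow1 s) q) =
  (fun s => \sum_(j < size (betaP R[i] K)) (- (betaP R[i] K)`_j) * pow1 s (q + j%:R)).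
  apply/funext => s; rewrite /shiftop -sumrN.
  by apply: eq_bigr => j _; rewrite mulNr.
exact: (jet_sum (index_enum 'I_(size (betaP R[i] K))) (fun j : 'I__ => hd j)).
Qed.

Lemma sum_diff_error K s N :
  series (fun n : nat => diff_error K s (q + n%:R) : Cplx R) N =
  (1 - s) * series (fun n : nat => cpow (q + n%:R) (- s) : Cplx R) N -
  (shiftop (betaP _ K) (pow1 s) (q + N%:R) - shiftop (betaP _ K) (pow1 s) q).
Proof.
by rewrite /series /= -sum_shiftop_diff mulr_sumr -sumrB.
Qed.

(* The two sides differ by the limit of a multiple of the (K+1)-st difference of
   x ^ (1 - s), which is itself a difference of two summable remainders. *)
Lemma hurwitz_cont_succ K s : (0 < K)%N -> complex.Re (1 - s) + 5 <= K.+1%:R ->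
  hurwitz_cont K.+1 s = hurwitz_cont K.+2 s.
Proof.
move=> K0 sK.
have sK1 : complex.Re (1 - s) + 5 <= K.+2%:R by apply: le_trans sK _; rewrite ler_nat.
have sK2 : complex.Re (1 - s) + 5 <= K.+3%:R by apply: le_trans sK1 _; rewrite ler_nat.
have r0 := cvg_series_cvg_0 (cvg_diff_error K0 sK).
have r1 := cvg_series_cvg_0 (cvg_diff_error (ltn0Sn K) sK1).
(* The polynomial (X - 1)^(K+1) separates [alphaP K] from [alphaP K.+1], and also [betaP K.+1] from
   [betaP K.+2]. The first fact makes u tend to 0, which uses the error at order K; the second
   compares the two sides. *)
pose u (n : nat) : Cplx R := shiftop (('X - 1) ^+ K.+1) (pow1 s) (q + n%:R).
have cn0 : ((-1) ^+ K / K.+1%:R : R[i]) != 0.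
  by rewrite mulf_neq0 ?signr_eq0// invr_eq0 pnatr_eq0.
have u0 : u @ \oo --> (0 : Cplx R).
  have -> : u = fun n => ((-1) ^+ K / K.+1%:R : R[i])^-1 *:
    ((fun n : nat => diff_error K s (q + n%:R) : Cplx R) - (fun n : nat => diff_error K.+1 s (q + n%:R) : Cplx R)) n.
    apply/funext => n; rewrite !fctE /GRing.scale /=.
    have -> : diff_error K s (q + n%:R) - diff_error K.+1 s (q + n%:R) = (-1) ^+ K / K.+1%:R * u n.
      by rewrite /diff_error alphaPS shiftopD shiftopZ /u; ring.
    by rewrite mulKf.
  have -> : (0 : Cplx R) = ((-1) ^+ K / K.+1%:R : R[i])^-1 *: ((0 : Cplx R) - 0).
    by rewrite subrr scaler0.
  exact: (@cvgZl_tmp R[i] (Cplx R) nat \oo _ _ _ _ (cvgB r0 r1)).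
have h1 := cvg_diff_error (ltn0Sn K) sK1.
have h2 := cvg_diff_error (ltn0Sn K.+1) sK2.
pose c : R[i] := (-1) ^+ K.+1 / K.+2%:R.
have b n : shiftop (betaP _ K.+2) (pow1 s) n =
  shiftop (betaP _ K.+1) (pow1 s) n + c * shiftop (('X - 1) ^+ K.+1) (pow1 s) n.
  by rewrite /betaP big_ord_recr /= shiftopD shiftopZ.
set S1 := fun n : nat => diff_error K.+1 s (q + n%:R) : Cplx R.
set S2 := fun n : nat => diff_error K.+2 s (q + n%:R) : Cplx R.
pose k : Cplx R := c * shiftop (('X - 1) ^+ K.+1) (pow1 s) q.
have e n : series S1 n = series S2 n + c *: u n - k.
  rewrite /S1 /S2 (sum_diff_error K.+1) (sum_diff_error K.+2) !b /u /k /GRing.scale /=.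
  move: (series _ n) (shiftop (betaP _ _) _ (q + _)) (shiftop (betaP _ _) _ q).
  move: (shiftop (('X - 1) ^+ K.+1) _ q) (shiftop (('X - 1) ^+ K.+1) _ (q + _)) (1 - s).
  by move=> x1 x2 x3 x4 x5 x6; ring.
have h3 : (c \*: u) @ \oo --> c *: (0 : Cplx R) by exact: (@cvgZl_tmp R[i] (Cplx R) nat \oo _ c u 0 u0).
have h4 : (fun n => series S2 n + c *: u n - k) @ \oo --> limn (series S2) + c *: (0 : Cplx R) - k.
  exact: (@cvgB R[i] (Cplx R) nat \oo _ _ _ _ _
    (@cvgD R[i] (Cplx R) nat \oo _ _ _ _ _ h2 h3) (@cvg_cst _ k nat \oo _)).
have {h3}h4' : series S1 @ \oo --> limn (series S2) + c *: (0 : Cplx R) - k.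
  by rewrite (_ : series S1 = fun n => series S2 n + c *: u n - k)//; apply/funext.
rewrite /hurwitz_cont b -/S1 -/S2 (cvg_limC _ h4') scaler0 /k.
move: (limn _) (shiftop (betaP _ _) _ q) (shiftop (('X - 1) ^+ _) _ q) => x1 x2 x3.
ring.
Qed.

End HurwitzContinuation.

(** * Meromorphic functions *)

Section Meromorphic.
Variables (R : realType) (V : normedModType R[i]).
Implicit Types (f g h : V -> Cplx R) (U W : set V).

Lemma differentiable_cstC (c : Cplx R) (z : V) : differentiable (fun=> c) z.
Proof. exact: (@differentiable_cst R[i] V (Cplx R) c z). Qed.

Lemma differentiableMC f g z : differentiable f z -> differentiable g z ->
  differentiable (fun x => f x * g x) z.
Proof. exact: (@differentiableM R[i] V f g z). Qed.

Lemma differentiableDC f g z : differentiable f z -> differentiable g z ->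
  differentiable (fun x => f x + g x) z.
Proof. exact: (@differentiableD R[i] V (Cplx R) f g z). Qed.

Lemma differentiable_extC f g z : f =1 g -> differentiable f z -> differentiable g z.
Proof. by move=> /funext ->. Qed.

Lemma open_neq0 h U W : holomorphic_on U h -> open W -> W `<=` U ->
  open (W `&` [set z | h z != 0]).
Proof.
move=> dh oW WU; rewrite openE => z [Wz hz].
have c : {for z, continuous h} by apply: differentiable_continuous; exact: dh (WU _ Wz).
apply: filterI; first exact: open_nbhs_nbhs.
have n0 : 0 < normc (h z) by rewrite lt_neqAle normc_ge0 eq_sym normc_eq0 hz.
have /cvg_normcP /(_ _ n0) := c; apply: filterS => t.
by apply: contraTneq => ->; rewrite subr0 ltxx.
Qed.

Lemma holomorphic_meromorphic f : holomorphic_on setT f -> meromorphic f.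
Proof.
move=> df a; exists setT, f, (fun=> 1); split.
- by split => //; exact: openT.
- exact: df.
- by move=> z _; exact: differentiable_cstC.
- by move=> W _ _ [z Wz]; exists z => //; exact: oner_neq0.
- by move=> z _ _; rewrite /= divr1.
Qed.

(** By continuity h1 is nonzero on a nonempty open part of W, and h2 is then tested on that part. *)
Lemma nonvanishingM U1 U2 h1 h2 : open U1 ->
  holomorphic_on U1 h1 ->
  (forall W, open W -> W `<=` U1 -> W !=set0 -> exists2 z, W z & h1 z != 0) ->
  (forall W, open W -> W `<=` U2 -> W !=set0 -> exists2 z, W z & h2 z != 0) ->
  forall W, open W -> W `<=` U1 `&` U2 -> W !=set0 ->
  exists2 z, W z & h1 z * h2 z != 0.
Proof.
move=> oU1 d1 n1 n2 W oW WU [w Ww].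
have W1 : W `<=` U1 by move=> z /WU[].
have W2 : W `<=` U2 by move=> z /WU[].
have [z1 Wz1 hz1] := n1 W oW W1 (ex_intro _ _ Ww).
have [||z [Wz /= h1z] h2z] := n2 (W `&` [set z | h1 z != 0]) (open_neq0 d1 oW W1).
- by move=> z [/W2].
- by exists z1.
- by exists z => //; rewrite mulf_neq0.
Qed.

Lemma meromorphicM f g : meromorphic f -> meromorphic g ->
  meromorphic (fun z => f z * g z).
Proof.
move=> mf mg a.
have [U1 [g1 [h1 [[oU1 U1a] dg1 dh1 n1 e1]]]] := mf a.
have [U2 [g2 [h2 [[oU2 U2a] dg2 dh2 n2 e2]]]] := mg a.
exists (U1 `&` U2), (fun z => g1 z * g2 z), (fun z => h1 z * h2 z); split.
- by split => //; exact: openI.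
- by move=> z [z1 z2]; apply: differentiableMC; [exact: dg1|exact: dg2].
- by move=> z [z1 z2]; apply: differentiableMC; [exact: dh1|exact: dh2].
- exact: nonvanishingM.
- move=> z [z1 z2]; rewrite mulf_eq0 negb_or => /andP[h1z h2z].
  by rewrite e1// e2// invfM mulrACA.
Qed.

Lemma meromorphicD f g : meromorphic f -> meromorphic g ->
  meromorphic (fun z => f z + g z).
Proof.
move=> mf mg a.
have [U1 [g1 [h1 [[oU1 U1a] dg1 dh1 n1 e1]]]] := mf a.
have [U2 [g2 [h2 [[oU2 U2a] dg2 dh2 n2 e2]]]] := mg a.
exists (U1 `&` U2), (fun z => g1 z * h2 z + g2 z * h1 z), (fun z => h1 z * h2 z); split.
- by split => //; exact: openI.
- move=> z [z1 z2]; apply: differentiableDC.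
    by apply: differentiableMC; [exact: dg1|exact: dh2].
  by apply: differentiableMC; [exact: dg2|exact: dh1].
- by move=> z [z1 z2]; apply: differentiableMC; [exact: dh1|exact: dh2].
- exact: nonvanishingM.
- move=> z [z1 z2]; rewrite mulf_eq0 negb_or => /andP[h1z h2z].
  by rewrite e1// e2// addf_div.
Qed.

Lemma meromorphic_cst (c : Cplx R) : meromorphic (fun _ : V => c).
Proof. by apply: holomorphic_meromorphic => z _; exact: differentiable_cstC. Qed.

Lemma meromorphic_sum (I : Type) (s : seq I) (f : I -> V -> Cplx R) :
  (forall i, meromorphic (f i)) -> meromorphic (fun z => \sum_(i <- s) f i z).
Proof.
move=> mf; elim: s => [|i s IH].
  have -> : (fun z => \sum_(i <- [::]) f i z) = fun=> 0 by apply/funext => z; rewrite big_nil.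
  exact: meromorphic_cst.
have -> : (fun z => \sum_(j <- i :: s) f j z) = (fun z => f i z + \sum_(j <- s) f j z).
  by apply/funext => z; rewrite big_cons.
exact: meromorphicD.
Qed.

Lemma meromorphic_prod (I : Type) (s : seq I) (f : I -> V -> Cplx R) :
  (forall i, meromorphic (f i)) -> meromorphic (fun z => \prod_(i <- s) f i z).
Proof.
move=> mf; elim: s => [|i s IH].
  have -> : (fun z => \prod_(i <- [::]) f i z) = fun=> 1 by apply/funext => z; rewrite big_nil.
  exact: meromorphic_cst.
have -> : (fun z => \prod_(j <- i :: s) f j z) = (fun z => f i z * \prod_(j <- s) f j z).
  by apply/funext => z; rewrite big_cons.
exact: meromorphicM.
Qed.

(* The hypothesis on e makes L an open map. *)
Lemma meromorphic_comp (L : V -> Cplx R) (e : V) (Z : Cplx R -> Cplx R) :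
  (forall z, differentiable L z) -> (forall z t, L (z + t *: e) = L z + t) ->
  meromorphic Z -> meromorphic (Z \o L).
Proof.
move=> dL Le mZ a.
have cL : continuous L by move=> z; apply: differentiable_continuous; exact: dL.
have oL W : open W -> open (L @` W).
  move=> oW; rewrite openE => _ [z Wz <-].
  have c0 : (fun u : Cplx R => u - L z) @ nbhs (L z) --> L z - L z.
    exact: (@cvgB R[i] (Cplx R) _ _ _ _ _ _ _ (@cvg_id _ (nbhs (L z))) (@cvg_cst _ (L z) _ _ _)).
  have c : (fun u : Cplx R => z + (u - L z) *: e) @ nbhs (L z) --> z + (L z - L z) *: e.
    exact: (@cvgD R[i] V _ _ _ _ _ _ _ (@cvg_cst _ z _ _ _) (@cvgZr_tmp R[i] V _ _ _ _ _ e c0)).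
  have /c Wz' : nbhs (z + (L z - L z) *: e) W.
    by rewrite subrr scale0r addr0; exact: open_nbhs_nbhs.
  apply: (@filterS _ (nbhs (L z)) _ _ _ _ Wz') => u Wu.
  exists (z + (u - L z) *: e) => //.
  by rewrite Le addrC subrK.
have [U [g [h [[oU Ua] dg dh n eZ]]]] := mZ (L a).
exists (L @^-1` U), (g \o L), (h \o L); split.
- by split => //; apply: open_comp => // z _; exact: cL.
- by move=> z Uz; apply: differentiable_comp; [exact: dL|exact: dg].
- by move=> z Uz; apply: differentiable_comp; [exact: dL|exact: dh].
- move=> W oW WU [w Ww].
  have [||_ [z Wz <-] hz] := n _ (oL _ oW).
  + by move=> _ [z Wz <-]; exact: WU.
  + by exists (L w), w.
  + by exists z.
- by move=> z Uz hz; exact: eZ.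
Qed.

End Meromorphic.

(** * Existence of the Hurwitz zeta function *)

Section HurwitzExists.
Variables (R : realType).
Implicit Types (s : Cplx R) (x : R) (K : nat).

Lemma jet_ext s0 (f g : Cplx R -> Cplx R) d A :
  (forall h, normc h <= 1 -> f (s0 + h) = g (s0 + h)) ->
  jet s0 g d A -> jet s0 f d A.
Proof.
move=> fg; have fg0 : f s0 = g s0.
  by have := fg 0; rewrite addr0; apply; rewrite normc0.
by move=> [g1 g2 g3]; split; rewrite ?fg0// => h hh; rewrite fg//; exact: g3.
Qed.

Lemma holomorphic_cpow (x : R) : 0 < x -> holomorphic_on setT (cpow x : Cplx R -> Cplx R).
Proof.
move=> x0 s _; have [x1|x1] := leP 1 x; first exact: jet_differentiable (jet_cpow s x1).
(* Jets of powers are available for bases at least 1, so x^s is written (1/x)^(-s). *)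
have x1' : 1 <= x^-1 by rewrite invf_ge1// ltW.
have := jet_compB (jet_cpow (0 - s) x1') => /jet_differentiable.
apply: differentiable_extC => t.
by rewrite /cpow lnV ?posrE// rmorphN sub0r mulrNN.
Qed.

Lemma holomorphic_cpowN (x : R) : 0 < x ->
  holomorphic_on setT (fun s : Cplx R => cpow x (- s) : Cplx R).
Proof.
move=> x0 s _; have i0 : 0 < x^-1 by rewrite invr_gt0.
have := holomorphic_cpow i0 (I : setT s); apply: differentiable_extC => t.
by rewrite /cpow lnV ?posrE// rmorphN mulrN mulNr.
Qed.

Lemma normc_cpow_series_le (q : R) s (n : nat) : 1 <= q -> 0 <= complex.Re s ->
  normc (cpow (q + n%:R) (- s)) <= n.+1%:R `^ (- complex.Re s).
Proof.
move=> q1 s0; have p : 0 < q + n%:R := lt_le_trans ltr01 (qn_ge1 q1 n).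
rewrite normc_cpow (raddfN (@complex.Re R)) /powR gt_eqF// ler_expR !mulNr lerN2.
rewrite ler_wpM2l// ler_ln ?posrE//.
by rewrite -natr1 addrC lerD2r.
Qed.

Lemma cvg_hurwitz_series (q : R) s : 1 <= q -> 1 < complex.Re s ->
  cvgn (series (fun n : nat => cpow (q + n%:R) (- s) : Cplx R)).
Proof.
move=> q1 s1; apply: cvg_series_normc.
apply: series_le_cvg (cvg_series_powR s1) => n; first exact: normc_ge0.
  exact: powR_ge0.
by apply: normc_cpow_series_le => //; exact: le_trans (ltW s1).
Qed.

Lemma cvg_powR0 (p : R) : 0 < p -> (fun n : nat => n.+1%:R `^ (- p)) @ \oo --> (0 : R).
Proof.
move=> p0; apply/cvgrPdist_lt => e e0; near=> n.
rewrite sub0r normrN ger0_norm ?powR_ge0// /powR gt_eqF// -[ltRHS]lnK ?posrE//.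
rewrite ltr_expR mulNr -ltrN2 opprK -ltr_pdivrMl// -ltr_expR lnK ?posrE//.
apply: (@lt_trans _ _ n%:R); last by rewrite ltr_nat.
by near: n; exact: nbhs_infty_gtr.
Unshelve. all: by end_near. Qed.

(** For 1 < Re s the modulus of x^(1 - s) tends to 0. This is the boundary term at infinity of the
    telescoped sum. *)
Lemma cvg_shiftop_pow1 (p : {poly R[i]}) (q : R) s : 1 <= q -> 1 < complex.Re s ->
  (fun n : nat => shiftop p (pow1 s) (q + n%:R) : Cplx R) @ \oo --> (0 : Cplx R).
Proof.
move=> q1 s1; apply/cvg_normcP => e e0.
pose C := \sum_(j < size p) normc p`_j.
have C0 : 0 <= C by apply: sumr_ge0 => j _; exact: normc_ge0.
have s1' : 0 < complex.Re s - 1 by lra.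
have Ce : 0 < e / (C + 1) by rewrite divr_gt0//; lra.
have /cvgrPdist_lt /(_ _ Ce) := cvg_powR0 s1'; apply: filterS => n.
rewrite sub0r normrN ger0_norm ?powR_ge0// ltr_pdivlMr; last by lra.
move=> h; rewrite sub0r normcN; apply: le_lt_trans h.
apply: (@le_trans _ _ (C * n.+1%:R `^ (- (complex.Re s - 1)))); last first.
  by rewrite mulrC ler_wpM2l ?powR_ge0//; lra.
rewrite /shiftop; apply: le_trans (le_normc_sum _ _ _) _.
rewrite mulr_suml; apply: ler_sum => j _; rewrite normcM ler_wpM2l ?normc_ge0//.
rewrite /pow1; have -> : 1 - s = - (s - 1) by rewrite opprB.
have qj : 1 <= q + j%:R := qn_ge1 q1 j.
rewrite addrAC; apply: le_trans (normc_cpow_series_le _ qj _) _.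
  by rewrite (raddfB (@complex.Re R)) /= ltW.
by rewrite (raddfB (@complex.Re R)).
Qed.

Section GE1.
Variable q : R.
Hypothesis q1 : 1 <= q.

Lemma hurwitz_cont_stable K K' s : (2 <= K)%N -> (K <= K')%N -> complex.Re (1 - s) + 5 <= K%:R ->
  hurwitz_cont q K' s = hurwitz_cont q K s.
Proof.
move=> K2 KK' sK; rewrite -(subnKC KK'); elim: (K' - K)%N => [|m IH]; first by rewrite addn0.
rewrite addnS -IH.
case: K K2 {KK' IH} sK => [|[|K]]// _ sK; rewrite (addSn K.+1); symmetry; apply: hurwitz_cont_succ => //.
by apply: le_trans sK _; rewrite ler_nat ltnS leq_addr.
Qed.

(** Using 6 instead of 5 leaves a margin of 1, so that the order chosen at s serves on the whole
    unit disc around s, as jets require. The [.+2] secures the side condition 2 <= K. *)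
Definition cont_order s : nat := (Num.bound (`|complex.Re (1 - s) + 6|)).+2.

Lemma cont_order_ge s : complex.Re (1 - s) + 6 <= (cont_order s)%:R.
Proof.
have h := archi_boundP (normr_ge0 (complex.Re (1 - s) + 6)).
apply: le_trans (ler_norm _) _.
by apply: le_trans (ltW h) _; rewrite ler_nat; exact: leqW (leqnSn _).
Qed.

(* The entire function (1 - s) zeta(s, q). *)
Definition hurwitz_entire s : Cplx R := hurwitz_cont q (cont_order s) s.

Lemma hurwitz_entire_eq K s : (2 <= K)%N -> complex.Re (1 - s) + 5 <= K%:R -> hurwitz_entire s = hurwitz_cont q K s.
Proof.
move=> K2 sK; rewrite /hurwitz_entire; set B := cont_order s.
have sB : complex.Re (1 - s) + 5 <= B%:R by apply: le_trans (cont_order_ge s); lra.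
have [BK|KB] := leqP B K.
  by rewrite [RHS](@hurwitz_cont_stable B).
by rewrite (@hurwitz_cont_stable K)// ltnW.
Qed.

Lemma jet_hurwitz_entire s0 : exists d A, jet s0 hurwitz_entire d A.
Proof.
pose K := cont_order s0.
have sK : complex.Re (1 - s0) + 6 <= K%:R := cont_order_ge s0.
have [|d [A J]] := @jet_hurwitz_cont R q q1 K s0 isT.
  by rewrite -natr1; lra.
exists d, A; apply: jet_ext J => h hh; apply: hurwitz_entire_eq => //.
have := normRe_le h; have := ler_norm (- complex.Re h); rewrite normrN.
have -> : 1 - (s0 + h) = (1 - s0) - h by ring.
by rewrite (raddfB (@complex.Re R)); move: sK; lra.
Qed.

(** In the limit the boundary term at infinity disappears, and the one at q cancels the second
    summand of [hurwitz_cont]. *)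
Lemma hurwitz_entire_series s : 1 < complex.Re s -> hurwitz_entire s = (1 - s) * hurwitz_series q s.
Proof.
move=> s1; pose K := cont_order s.
have sK : complex.Re (1 - s) + 6 <= K%:R := cont_order_ge s.
rewrite (@hurwitz_entire_eq K)//; last by lra.
pose S := fun n : nat => cpow (q + n%:R) (- s) : Cplx R.
have -> : hurwitz_series q s = limn (series S).
  rewrite /hurwitz_series; congr (limn (series _)).
  by apply/funext => n; rewrite addrC.
have cS := cvg_hurwitz_series q1 s1.
have c0 := cvg_shiftop_pow1 (betaP _ K) q1 s1.
pose k : Cplx R := shiftop (betaP _ K) (pow1 s) q.
have h1 : ((1 - s : R[i]) \*: series S) @ \oo --> (1 - s : R[i]) *: limn (series S).
  exact: (@cvgZl_tmp R[i] (Cplx R) nat \oo _ (1 - s) _ _ cS).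
have h2 : (fun n => (1 - s : R[i]) *: series S n -
   ((shiftop (betaP _ K) (pow1 s) (q + n%:R) : Cplx R) - k)) @ \oo -->
   (1 - s : R[i]) *: limn (series S) - ((0 : Cplx R) - k).
  exact: (@cvgB R[i] (Cplx R) nat \oo _ _ _ _ _ h1
    (@cvgB R[i] (Cplx R) nat \oo _ _ _ _ _ c0 (@cvg_cst _ k nat \oo _))).
have h3 : series (fun n : nat => diff_error K s (q + n%:R) : Cplx R) @ \oo -->
   (1 - s : R[i]) *: limn (series S) - ((0 : Cplx R) - k).
  rewrite (_ : series _ = (fun n => (1 - s : R[i]) *: series S n -
   ((shiftop (betaP _ K) (pow1 s) (q + n%:R) : Cplx R) - k)))//.
  by apply/funext => n; rewrite sum_diff_error.
rewrite /hurwitz_cont (cvg_limC _ h3) -/k sub0r opprK addrK//.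
Qed.

Lemma is_hurwitz_quotient : is_hurwitz q (fun s => hurwitz_entire s / (1 - s)).
Proof.
have d1 : holomorphic_on setT hurwitz_entire.
  by move=> s _; have [d [A J]] := jet_hurwitz_entire s; exact: jet_differentiable J.
have d2 s : differentiable (fun s : Cplx R => 1 - s : Cplx R) s.
  have := jet_differentiable (jet_aff s 1 (-1)).
  by apply: differentiable_extC => t; rewrite mulN1r.
split.
- move=> s s1; rewrite hurwitz_entire_series//; rewrite mulrAC mulfV ?mul1r//.
  by rewrite subr_eq0; apply: contraTneq s1 => <- /=; rewrite ltxx.
- move=> s /= s1; apply: differentiableMC; first exact: d1.
  apply: (@differentiableV R[i] (Cplx R) (fun s => 1 - s) s); first exact: d2.
  by rewrite subr_eq0 eq_sym.
- move=> a; exists setT, hurwitz_entire, (fun s => 1 - s); split => //.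
  + by split => //; exact: openT.
  + move=> W oW _ [w Ww]; have [w1|w1] := eqVneq w 1; last first.
      by exists w => //; rewrite subr_eq0 eq_sym.
    have : nbhs (w : Cplx R) W by exact: open_nbhs_nbhs.
    (* If the given point is the zero 1 of 1 - s, a point at distance e / 2 still lies in W. *)
    move=> /nbhs_ballP[e /= e0 eW]; exists (1 + e / 2).
      apply: eW; rewrite -ball_normE /= w1 opprD addrA subrr sub0r normrN.
      rewrite gtr0_norm ?divr_gt0// ltr_pdivrMr// mulr_natr mulr2n ltrDl//.
    by rewrite opprD addrA subrr sub0r oppr_eq0 mulf_neq0 ?invr_eq0 ?pnatr_eq0// gt_eqF.
Qed.

End GE1.

Lemma hurwitz_series_succ (q : R) s : 0 < q -> 1 < complex.Re s ->
  hurwitz_series q s = cpow q (- s) + hurwitz_series (q + 1) s.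
Proof.
move=> q0 s1; rewrite /hurwitz_series.
have q1 : 1 <= q + 1 by lra.
set S := fun k : nat => cpow (k%:R + q) (- s) : Cplx R.
set S1 := fun k : nat => cpow (k%:R + (q + 1)) (- s) : Cplx R.
have c : cvgn (series S1).
  have := cvg_hurwitz_series q1 s1.
  by congr (cvgn (series _)); apply/funext => n; rewrite addrC.
have e n : series S n.+1 = cpow q (- s) + series S1 n.
  rewrite /series /= big_nat_recl//= /S add0r; congr (_ + _).
  by apply: eq_bigr => k _; rewrite /S1 -natr1 -addrA (addrC 1).
apply: cvg_limC; rewrite -(cvg_shiftS (series S)).
rewrite (_ : [sequence series S n.+1]_n = fun n => (cpow q (- s) : Cplx R) + series S1 n).
  exact: (@cvgD R[i] (Cplx R) nat \oo _ _ _ _ _ (@cvg_cst _ _ nat \oo _) c).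
by apply/funext.
Qed.

(** The estimates need bases at least 1. Continuing from q + 1 and adding back the entire term
    q^(-s) covers every q > 0. *)
Lemma hurwitz_exists (q : R) : 0 < q -> exists Z : Cplx R -> Cplx R, is_hurwitz q Z.
Proof.
move=> q0; have q1 : 1 <= q + 1 by lra.
pose Z s : Cplx R := hurwitz_entire (q + 1) s / (1 - s).
have [h1 h2 h3] : is_hurwitz (q + 1) Z := is_hurwitz_quotient q1.
have dq := holomorphic_cpowN q0.
exists (fun s => cpow q (- s) + Z s); split.
- by move=> s s1; rewrite hurwitz_series_succ// h1.
- by move=> s s1; apply: differentiableDC; [exact: dq|exact: h2].
- by apply: meromorphicD => //; exact: holomorphic_meromorphic.
Qed.

Lemma hurwitz_zetaP (q : R) : 0 < q -> is_hurwitz q (fun s => hurwitz_zeta s q).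
Proof.
move=> /hurwitz_exists[Z hZ]; rewrite /hurwitz_zeta.
have -> : (fun s => xget (fun=> 0) [set Z | is_hurwitz q Z] s) =
  xget (fun=> 0) [set Z | is_hurwitz q Z] by [].
exact: (xgetPex (P := [set Z | is_hurwitz q Z]) (fun=> 0) (ex_intro _ Z hZ)).
Qed.

End HurwitzExists.

(** * Counting homomorphisms *)

Lemma card_fset_set_image (T U : choiceType) (f : T -> U) (A : set T) (B : set U) :
  finite_set A -> {in A &, injective f} -> f @` A = B ->
  #|` fset_set A|%fset = #|` fset_set B|%fset.
Proof.
move=> finA injf <-; apply/fcard_eq => //; first exact: finite_image.
by rewrite card_eq_sym; exact: inj_card_eq.
Qed.

Lemma card_fset_set_uniq (T : choiceType) (A : set T) (s : seq T) :
  finite_set A -> uniq s -> (forall x, (x \in s) = (x \in A)) ->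
  #|` fset_set A|%fset = size s.
Proof.
move=> finA us sA; apply/perm_size/uniq_perm => // x.
by rewrite in_fset_set// sA.
Qed.

Lemma card_fset_setT (T : finType) : #|` fset_set [set: T]|%fset = #|T|.
Proof.
rewrite cardE; apply: card_fset_set_uniq; rewrite ?enum_uniq//.
  exact: finite_finset.
by move=> x; rewrite mem_enum in_setT.
Qed.

Lemma card_fset_setX (T U : choiceType) (A : set T) (B : set U) :
  finite_set A -> finite_set B ->
  #|` fset_set (A `*` B)|%fset = (#|` fset_set A|%fset * #|` fset_set B|%fset)%N.
Proof.
move=> finA finB; rewrite -(size_allpairs pair).
apply: card_fset_set_uniq; first exact: finite_setX.
  by apply: allpairs_uniq => // -[a b] [c d] _ _ [-> ->].
move=> [x y]; rewrite in_setX; apply/allpairsP/idP => /= [[[a b] /=]|].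
  by rewrite !in_fset_set// => -[ha hb [-> ->]]; rewrite ha hb.
by move=> /andP[hx hy]; exists (x, y); rewrite !in_fset_set.
Qed.

Section Homs.
Variable m : nat.
Local Notation A := 'I_m.+1.

(** The modulus is m + 1, so that ['I_m.+1] is a group for every m; this is the set that
    [num_hom G m.+1] counts. *)
Definition homs (G : groupType) : set (G -> A) :=
  [set f | forall x y : G, f (x * y)%g = (f x + f y)%R].

Arguments homs : clear implicits.

Lemma finite_homs (Gam : finGroupType) : finite_set (homs Gam).
Proof.
apply: (@sub_finite_set _ _ ((fun f : {ffun Gam -> A} => f : Gam -> A) @` setT)).
  by move=> f _; exists (finfun f) => //; apply/funext => x; rewrite ffunE.
by apply: finite_image; exact: finite_finset.
Qed.

Lemma hom1 (G : groupType) (f : G -> A) : homs G f -> f 1%g = 0.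
Proof. by move=> hf; have := hf 1%g 1%g; rewrite mulg1 => /eqP; rewrite -subr_eq subrr => /eqP. Qed.

Lemma homs_gt0 (Gam : finGroupType) : (0 < #|` fset_set (homs Gam)|%fset)%N.
Proof.
rewrite cardfs_gt0; apply/fset0Pn; exists (fun=> 0).
rewrite in_fset_set; last exact: finite_homs.
by apply/mem_set => x y; rewrite addr0.
Qed.

End Homs.
Arguments homs : clear implicits.

Section FreePart.
Variables (k n : nat) (G : groupType) (Gam : finGroupType).
Local Notation A := 'I_k.+1.
Variable phi : G -> 'rV[int]_n * Gam.
Hypothesis phi_bij : bijective phi.
Hypothesis phiM : forall x y : G, phi (x * y)%g =
  ((phi x).1 + (phi y).1, ((phi x).2 * (phi y).2)%g).

(* A homomorphism on Z^n x Gam from the images of the unit vectors and its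
   restriction to Gam. *)
Definition glue_hom (p : {ffun 'I_n -> A} * (Gam -> A)) : G -> A :=
  fun g => \sum_i p.1 i *~ (phi g).1 0 i + p.2 (phi g).2.

Lemma glue_hom_image : glue_hom @` (setT `*` homs k Gam) = homs k G.
Proof.
have [psi psiK phiK] := phi_bij.
have psiM u v : psi (u.1 + v.1, (u.2 * v.2)%g) = (psi u * psi v)%g.
  by apply: (bij_inj phi_bij); rewrite phiM !phiK.
apply/seteqP; split => [_ [[a h] /= [_ hh] <-] x y|f hf].
  rewrite /glue_hom phiM /= hh addrACA -big_split /=; congr (_ + _).
  by apply: eq_bigr => i _; rewrite mxE mulrzDr.
pose F (v : 'rV[int]_n) := f (psi (v, 1%g)).
have FD : {morph F : u v / u + v}.
  by move=> u v; rewrite /F -hf -psiM /= mulg1.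
have F0 : F 0 = 0 by have /eqP := FD 0 0; rewrite addr0 -subr_eq subrr => /eqP.
have FN u : F (- u) = - F u by apply/eqP; rewrite -addr_eq0 -FD addNr F0.
have Fn u (j : nat) : F (u *+ j) = F u *+ j.
  by elim: j => [|j IH]; rewrite ?mulr0n ?mulrS ?FD ?IH.
have Fz u (z : int) : F (u *~ z) = F u *~ z.
  by case: z => j; rewrite ?NegzE ?mulrNz ?FN -?pmulrn ?Fn.
exists ([ffun i => F (delta_mx 0 i)], fun g => f (psi (0, g))).
  by split => // x y; rewrite -hf -psiM /= addr0.
apply/funext => g; rewrite /glue_hom /=.
have -> : g = psi (phi g) by rewrite psiK.
case: (phi g) => v c; rewrite phiK /=.
have -> : psi (v, c) = (psi (v, 1) * psi (0, c))%g by rewrite -psiM /= addr0 mul1g.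
rewrite hf; congr (_ + _); rewrite -/(F v) [in RHS](row_sum_delta v).
rewrite (big_morph F FD F0); apply: eq_bigr => i _.
by rewrite ffunE -Fz -scaler_int intz.
Qed.

Lemma glue_hom_inj : {in setT `*` homs k Gam &, injective glue_hom}.
Proof.
have [psi psiK phiK] := phi_bij.
move=> [a h] [b h'] /set_mem[_ /= hh] /set_mem[_ /= hh'] e.
have e1 g : glue_hom (a, h) (psi g) = glue_hom (b, h') (psi g) by rewrite e.
have sum0 (c : {ffun 'I_n -> A}) : \sum_i c i *~ (0 : 'rV[int]_n) 0 i = 0.
  by apply: big1 => i _; rewrite mxE mulr0z.
congr (_, _); last first.
  by apply/funext => g; have := e1 (0, g); rewrite /glue_hom phiK /= !sum0 !add0r.
apply/ffunP => i; have := e1 (delta_mx 0 i, 1%g).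
have sumd (c : {ffun 'I_n -> A}) : \sum_j c j *~ (delta_mx 0 i : 'rV[int]_n) 0 j = c i.
  rewrite (bigD1 i)//= mxE !eqxx mulr1z big1 ?addr0// => j ji.
  by rewrite mxE (negbTE ji) andbF mulr0z.
by rewrite /glue_hom phiK /= !sumd (hom1 hh) (hom1 hh') !addr0.
Qed.

End FreePart.

Lemma num_hom_split (G : groupType) (n : nat) (Gam : finGroupType) (m : nat) :
  (0 < m)%N -> splits_as G n Gam -> num_hom G m = (m ^ n * num_hom Gam m)%N.
Proof.
case: m => // k _ [phi [bphi phiM]].
have fin : finite_set ([set: {ffun 'I_n -> 'I_k.+1}] `*` homs k Gam).
  by apply: finite_setX; [exact: finite_finset|exact: finite_homs].
have := card_fset_set_image fin (glue_hom_inj (k := k) bphi) (glue_hom_image k bphi phiM).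
rewrite /num_hom -/(homs k G) => <-.
rewrite card_fset_setX; [|exact: finite_finset|exact: finite_homs].
by rewrite card_fset_setT card_ffun !card_ord.
Qed.

Section Torsion.
Variables (Gam : finGroupType) (d e m : nat).
Hypothesis m1E : m.+1 = (d.+1 * e.+1)%N.

Lemma scale_ord_proof (x : 'I_d.+1) : (x * e.+1 < m.+1)%N.
Proof. by rewrite m1E ltn_pmul2r. Qed.

(** The embedding of Z/(d+1) in Z/(m+1) as the subgroup of multiples of e + 1. *)
Definition scale_ord (x : 'I_d.+1) : 'I_m.+1 := Ordinal (scale_ord_proof x).

Lemma scale_ord_inj : injective scale_ord.
Proof. by move=> x y /(congr1 val) /= /eqP; rewrite eqn_pmul2r// => /eqP /val_inj. Qed.

Lemma scale_ordD : {morph scale_ord : x y / x + y}.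
Proof. by move=> x y; apply: val_inj; rewrite /= m1E -mulnDl -muln_modl. Qed.

(* The values of a homomorphism of exponent dividing [l] are killed by
   [gcdn l m.+1 = d.+1], hence lie in the image of [scale_ord]. *)
Lemma homs_scale_ord l : (exponent [set: Gam]%SET %| l)%N ->
  gcdn l m.+1 = d.+1 ->
  (fun f x => scale_ord (f x)) @` homs d Gam = homs m Gam.
Proof.
move=> El gcdl; apply/seteqP; split => [_ [f hf <-] x y|f hf].
  by rewrite hf scale_ordD.
have fX x n : f (x ^+ n)%g = f x *+ n.
  by elim: n => [|n IH]; rewrite ?expg0 ?(hom1 hf)// expgS hf IH mulrS.
have fl x : (m.+1 %| l * f x)%N.
  have : f x *+ l = 0.
    rewrite -fX -(hom1 hf); congr (f _); have /dvdnP[j ->] := El.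
    by rewrite mulnC expgM expg_exponent ?inE// expg1n.
  by rewrite Zp_mulrn => /(congr1 val) /= /eqP; rewrite mulnC.
(* As m + 1 divides both l f(x) and (m + 1) f(x), it divides their gcd (d + 1) f(x); cancel d +
   1. *)
have fe x : (e.+1 %| f x)%N.
  have : (m.+1 %| gcdn (l * f x) (m.+1 * f x))%N by rewrite dvdn_gcd fl dvdn_mulr.
  by rewrite -muln_gcdl gcdl {1}m1E dvdn_pmul2l.
have lt x : (f x %/ e.+1 < d.+1)%N by rewrite ltn_divLR// -m1E ltn_ord.
have fE x : scale_ord (Ordinal (lt x)) = f x by apply: val_inj; rewrite /= divnK.
exists (fun x => Ordinal (lt x)); last by apply/funext => x; rewrite fE.
by move=> x y; apply: scale_ord_inj; rewrite scale_ordD !fE hf.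
Qed.

Lemma card_homs_scale l : (exponent [set: Gam]%SET %| l)%N ->
  gcdn l m.+1 = d.+1 ->
  #|` fset_set (homs d Gam)|%fset = #|` fset_set (homs m Gam)|%fset.
Proof.
move=> El gcdl; apply: card_fset_set_image (homs_scale_ord El gcdl).
  exact: finite_homs.
move=> f g _ _ fg; apply/funext => x; apply: scale_ord_inj.
exact: (congr1 (fun h => h x) fg).
Qed.

End Torsion.

Lemma num_hom_gcd (Gam : finGroupType) (l m : nat) : (0 < m)%N ->
  (exponent [set: Gam]%SET %| l)%N -> num_hom Gam m = num_hom Gam (gcdn l m).
Proof.
case: m => // m _ El.
have d0 : (0 < gcdn l m.+1)%N by rewrite gcdn_gt0 orbT.
have e0 : (0 < m.+1 %/ gcdn l m.+1)%N by rewrite divn_gt0// dvdn_leq ?dvdn_gcdr.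
symmetry; apply: (@card_homs_scale _ _ (m.+1 %/ gcdn l m.+1).-1 _ _ l) => //; rewrite !prednK//.
by rewrite mulnC divnK// dvdn_gcdr.
Qed.

Lemma num_hom_modn (Gam : finGroupType) (l m m' : nat) : (0 < m)%N -> (0 < m')%N ->
  (exponent [set: Gam]%SET %| l)%N -> m = m' %[mod l] ->
  num_hom Gam m = num_hom Gam m'.
Proof.
move=> m0 m'0 El mm'.
by rewrite (num_hom_gcd m0 El) (num_hom_gcd m'0 El) -(gcdn_modr l m) mm' gcdn_modr.
Qed.

Lemma num_hom_gt0 (Gam : finGroupType) (m : nat) : (0 < m)%N -> (0 < num_hom Gam m)%N.
Proof. by move=> _; exact: homs_gt0. Qed.

(** * Finiteness of the space *)

Lemma finite_set_inj (T U : Type) (f : T -> U) (A : set T) :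
  {in A &, injective f} -> finite_set (f @` A) -> finite_set A.
Proof. by move=> /inj_card_eq /eq_finite_set ->. Qed.

Lemma spec_ext (M : pmonoidType) (p q : spec M) : (pideal p = pideal q) -> p = q.
Proof.
case: p q => [P p0 pM p1 pp] [Q q0 qM q1 qp] /= e; subst Q.
by congr PrimeIdeal; exact: Prop_irrelevance.
Qed.

Lemma finite_spec (M : pmonoidType) : finitely_generated M ->
  finite_set [set: spec M].
Proof.
move=> [gens hg].
pose F (p : spec M) : {ffun 'I_(size gens) -> bool} := [ffun i : 'I_(size gens) => `[< p (nth 1%g gens i) >]].
apply: (@finite_set_inj _ _ F); last first.
  exact: finite_finset.
move=> p q _ _ pq; apply: spec_ext; apply/funext => x; apply/propext.
apply: (hg (fun x => p x <-> q x)).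
- by split => /pideal1.
- by split => _; exact: pideal0.
- have mulP (q' : spec M) y z : q' (y * z)%g <-> q' y \/ q' z.
    split; first exact: pideal_prime.
    by case; [rewrite pmulgC|]; exact: pidealM.
  by move=> y z hy hz; rewrite !mulP hy hz.
- move=> y yg; have iy : (index y gens < size gens)%N by rewrite index_mem.
  have := congr1 (fun f : {ffun _ -> _} => f (Ordinal iy)) pq.
  rewrite !ffunE /= nth_index// => e; split => h; apply/asboolP.
    by rewrite -e; apply/asboolP.
  by rewrite e; apply/asboolP.
Qed.

Lemma finite_noetherian (X : monoidal_space) :
  noetherian_F1_scheme X -> finite_set [set: X].
Proof.
move=> [k [U [M [cover fg aff]]]]; rewrite -cover.
apply: bigcup_finite => [|i _]; first exact: finite_finset.
have [f [cf [theta [_ <- _ _ _]]]] := aff i.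
exact: finite_image (finite_spec (fg i)).
Qed.

(** * Unconditional sums of products *)

Section FsetSums.
Variable T : choiceType.

Lemma big_fset_subset (V : nmodType) (F : T -> V) (A B : {fset T}) :
  (A `<=` B)%fset ->
  \sum_(a <- B) F a = \sum_(a <- A) F a + \sum_(a <- B | a \notin A) F a.
Proof.
move=> /fsubsetP AB; rewrite (bigID (mem A)) /=; congr (_ + _).
rewrite -big_filter; apply: perm_big; apply: uniq_perm; rewrite ?filter_uniq ?fset_uniq//.
by move=> x; rewrite mem_filter andb_idr// => /AB.
Qed.

Lemma partial_sumE (V : zmodType) (F : T -> V) (A : {fset T}) :
  partial_sum F A = \sum_(a <- A) F a.
Proof. by rewrite /partial_sum big_seq_fsetE. Qed.

End FsetSums.

Section Boxes.
Variable r : nat.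
Local Notation idx := {ffun 'I_r -> nat}.

Definition box_val (N : nat) (b : {ffun 'I_r -> 'I_N}) : idx := [ffun i => val (b i)].

(** Boxes are cofinal among finite sets of indices, and over a box a sum of products factors into
    partial sums. *)
Definition box (N : nat) : {fset idx} :=
  [fset a in [seq box_val b | b <- enum {ffun 'I_r -> 'I_N}]]%fset.

Lemma in_box N (a : idx) : (a \in box N) = [forall i, a i < N]%N.
Proof.
rewrite inE /=; apply/mapP/forallP => [[b _ ->] i|h]; first by rewrite ffunE ltn_ord.
exists [ffun i => Ordinal (h i)]; first by rewrite mem_enum.
by apply/ffunP => i; rewrite !ffunE.
Qed.

Lemma sum_box (V : comNzRingType) (u : 'I_r -> nat -> V) N :
  \sum_(a <- box N) \prod_i u i (a i) = \prod_i series (u i) N.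
Proof.
transitivity (\sum_(b : {ffun 'I_r -> 'I_N}) \prod_i u i (b i)).
  rewrite (perm_big [seq box_val b | b <- enum {ffun 'I_r -> 'I_N}]) /=.
    rewrite big_map big_enum /=; apply: eq_bigr => b _.
    by apply: eq_bigr => i _; rewrite ffunE.
  apply: uniq_perm; rewrite ?fset_uniq//; last by move=> x; rewrite inE.
  rewrite map_inj_uniq ?enum_uniq// => b c /ffunP e; apply/ffunP => i.
  by have := e i; rewrite !ffunE => /val_inj.
rewrite -(bigA_distr_bigA (fun i (j : 'I_N) => u i j)) /=; apply: eq_bigr => i _.
by rewrite /series /= big_mkord.
Qed.

Lemma fset_in_box (J : {fset idx}) : exists N, (J `<=` box N)%fset.
Proof.
exists (\max_(a <- J) \max_i a i).+1; apply/fsubsetP => a aJ; rewrite in_box.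
apply/forallP => i; rewrite ltnS.
apply: (@leq_trans (\max_i a i)); first exact: (@leq_bigmax _ (fun i => a i) i).
exact: (@leq_bigmax_seq _ _ _ (fun a : idx => \max_i a i) a aJ isT).
Qed.

End Boxes.

Section SumProd.
Variables (R : realType) (r : nat).
Variables (u : 'I_r -> nat -> Cplx R) (S : 'I_r -> Cplx R) (g : 'I_r -> nat -> R).
Hypothesis ug : forall i n, normc (u i n) <= g i n.
Hypothesis cg : forall i, cvgn (series (g i)).
Hypothesis uS : forall i, series (u i) @ \oo --> S i.

Let g0 i n : 0 <= g i n.
Proof. exact: le_trans (normc_ge0 _) (ug i n). Qed.

Let G (a : {ffun 'I_r -> nat}) : R := \prod_i g i (a i).
Let U (a : {ffun 'I_r -> nat}) : Cplx R := \prod_i u i (a i).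
Let P := \prod_i limn (series (g i)).

Let G0 a : 0 <= G a.
Proof. by apply: prodr_ge0 => i _. Qed.

Lemma sum_prod_le (J : {fset {ffun 'I_r -> nat}}) : \sum_(a <- J) G a <= P.
Proof.
have [N JN] := fset_in_box J.
apply: (@le_trans _ _ (\sum_(a <- box r N) G a)).
  by rewrite (big_fset_subset _ JN) lerDl sumr_ge0.
rewrite sum_box; apply: ler_prod => i _; apply/andP; split.
  by apply: sumr_ge0.
by apply: nondecreasing_cvgn_le; [exact: nondecreasing_series|exact: cg].
Qed.

Lemma normc_prod (I : Type) (s : seq I) (f : I -> R[i]) :
  normc (\prod_(i <- s) f i) = \prod_(i <- s) normc (f i).
Proof.
by elim: s => [|i s IH]; rewrite ?big_nil ?normc1// !big_cons normcM IH.
Qed.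

Lemma cvg_bigprod (K : numFieldType) (I : Type) (s : seq I) (f : I -> nat -> K) (l : I -> K) :
  (forall i, f i @ \oo --> l i) ->
  (fun n => \prod_(i <- s) f i n) @ \oo --> \prod_(i <- s) l i.
Proof.
move=> fl; elim: s => [|i s IH].
  rewrite big_nil (_ : (fun n => \prod_(i <- [::]) f i n) = cst 1); first exact: cvg_cst.
  by apply/funext => n; rewrite big_nil.
rewrite big_cons (_ : (fun n => \prod_(j <- i :: s) f j n) =
  (f i \* (fun n => \prod_(j <- s) f j n))); first exact: cvgM.
by apply/funext => n; rewrite big_cons.
Qed.

(** For J containing a large box, the sum over the box is close to the product of the limits. The
    rest is dominated by the same part of the sum of G, at most P minus the sum of G over the
    box. *)
Lemma cvg_sum_prod : partial_sum U @ totally --> (\prod_i S i : Cplx R).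
Proof.
apply/cvg_normcP => e e0.
have e2 : 0 < e / 2 by lra.
have h1 : (fun n => \prod_i series (u i) n) @ \oo --> (\prod_i S i : Cplx R).
  exact: (@cvg_bigprod R[i] 'I_r (index_enum _) (fun i => series (u i)) S uS).
have h2 : (fun n => \prod_i series (g i) n) @ \oo --> P by exact: cvg_bigprod.
move/cvg_normcP/(_ _ e2) : h1 => h1.
move/cvgrPdist_lt/(_ _ e2) : h2 => h2.
have [N [h1N h2N]] : exists N, normc ((\prod_i S i) - \prod_i series (u i) N) < e / 2 /\
   `|P - \prod_i series (g i) N| < e / 2.
  have : \forall N \near \oo, normc ((\prod_i S i) - \prod_i series (u i) N) < e / 2 /\
   `|P - \prod_i series (g i) N| < e / 2 by apply: filterS2 h1 h2.
  by move=> /filter_ex.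
exists (box r N) => //= J NJ; rewrite partial_sumE (big_fset_subset _ NJ) sum_box.
rewrite opprD addrA; apply: le_lt_trans (le_normcB _ _) _.
have := sum_prod_le J; rewrite (big_fset_subset _ NJ) sum_box => hJ.
have : normc (\sum_(a <- J | a \notin box r N) U a) <= \sum_(a <- J | a \notin box r N) G a.
  apply: le_trans (le_normc_sum _ _ _) _; apply: ler_sum => a _.
  by rewrite /U normc_prod; apply: ler_prod => i _; rewrite normc_ge0 ug.
move: h2N; rewrite ltr_norml => /andP[_ h2N].
by move=> h; lra.
Qed.

End SumProd.

(** * Sums over residue classes *)

Section ResidueClass.
Variables (R : realType).

Lemma ReB (x y : R[i]) : complex.Re (x - y) = complex.Re x - complex.Re y.
Proof. by case: x y => [a b] [c d]. Qed.

Variables (z : Cplx R) (l : nat) (k : 'I_l).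
Hypothesis z1 : 1 < complex.Re z.

(** Index n stands for the integer n + 1, so k stands for the class of k + 1, with representatives
    1, ..., l as in the formula. *)
Definition class_term (n : nat) : Cplx R := (n %% l == k)%N%:R * cpow n.+1%:R (- z).

Lemma normc_class_term n : normc (class_term n) <= n.+1%:R `^ (- complex.Re z).
Proof.
rewrite normcM normc_cpow_powR// (raddfN (@complex.Re R)).
by case: eqP => _; rewrite ?normc1 ?mul1r// ?normc0 mul0r powR_ge0.
Qed.

(** The series converges absolutely, so its sum can be read off along partial sums of length Q l.
    There each block of length l has one nonzero term, (j l + k + 1)^(-z) = l^(-z) (j + (k + 1) /
    l)^(-z). *)
Lemma cvg_series_class_term : series class_term @ \oo -->
  (cpow l%:R (- z) * hurwitz_zeta z (k.+1%:R / l%:R) : Cplx R).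
Proof.
have l0 : (0 < l)%N by case: (l) (k) => // -[].
have lR : 0 < l%:R :> R by rewrite ltr0n.
have q0 : 0 < k.+1%:R / l%:R :> R by rewrite divr_gt0.
have cu : cvgn (series class_term).
  apply: cvg_series_normc; apply: series_le_cvg (cvg_series_powR z1) => n.
  - exact: normc_ge0.
  - exact: powR_ge0.
  - exact: normc_class_term.
set L := limn (series class_term) in cu.
have [hz _ _] := hurwitz_zetaP q0; rewrite (hz z z1).
pose c : R[i] := cpow l%:R (- z).
have c0 : c != 0.
  by rewrite -normc_eq0 normc_cpow gt_eqF// expR_gt0.
pose h (j : nat) : Cplx R := cpow (j%:R + k.+1%:R / l%:R) (- z).
have sub Q : series class_term (Q * l)%N = c * series h Q.
  rewrite /series /= big_nat_mul mulr_sumr; apply: eq_bigr => j _.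
  rewrite -[(j * l)%N]add0n big_addn mulSn addnK big_mkord.
  rewrite (bigD1 k)//= big1 ?addr0.
    have e : (k + j * l).+1%:R = l%:R * (j%:R + k.+1%:R / l%:R) :> R.
      rewrite mulrDr mulrCA mulfV ?gt_eqF// mulr1 -addSn natrD natrM.
      by rewrite addrC [X in X + _]mulrC.
    rewrite /class_term e /c /h cpowMl ?ltr_wpDl// addnC modnMDl modn_small// eqxx.
    by rewrite mul1r.
  move=> i ik; rewrite /class_term addnC modnMDl modn_small// (_ : (_ == _) = false) ?mul0r//.
  by apply: contraNF ik => /eqP/val_inj ->.
have cs : (fun Q => series class_term (Q * l)%N) @ \oo --> L.
  apply: (@cvg_comp _ _ _ (fun Q : nat => (Q * l)%N) (series class_term) \oo \oo); last exact: cu.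
  move=> A [N _ NA]; exists N => // n /= Nn; apply: NA => /=.
  by apply: leq_trans Nn _; exact: leq_pmulr.
have ch : series h @ \oo --> (c^-1 *: L : Cplx R).
  rewrite (_ : series h = c^-1 \*: (fun Q => series class_term (Q * l)%N)).
    exact: (@cvgZl_tmp R[i] (Cplx R) nat \oo _ c^-1 _ _ cs).
  by apply/funext => Q; rewrite /= sub /GRing.scale /= mulKf.
have hE : hurwitz_series (k.+1%:R / l%:R) z = c^-1 * L := cvg_limC _ ch.
have LE : cpow l%:R (- z) * hurwitz_series (k.+1%:R / l%:R) z = L by rewrite hE mulVKf.
by rewrite LE; exact: cu.
Qed.

End ResidueClass.

Section PointSum.
Variables (R : realType) (r : nat) (l : nat).
Hypothesis l_gt0 : (0 < l)%N.
Variables (z : 'I_r -> Cplx R) (H : {ffun 'I_r -> 'I_l} -> Cplx R).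
Hypothesis z1 : forall i, 1 < complex.Re (z i).

Definition class_idx (a : {ffun 'I_r -> nat}) : {ffun 'I_r -> 'I_l} :=
  [ffun i => Ordinal (ltn_pmod (a i) l_gt0)].

Definition class_prod (k : {ffun 'I_r -> 'I_l}) (a : {ffun 'I_r -> nat}) : Cplx R :=
  \prod_i class_term (z i) (k i) (a i).

Definition periodic_term (a : {ffun 'I_r -> nat}) : Cplx R :=
  H (class_idx a) * \prod_i cpow (a i).+1%:R (- z i).

(* Residue classes are cut out by products of indicators, which turns the term
   into a finite combination of pure products. *)
Lemma periodic_termE a : periodic_term a = \sum_k H k * class_prod k a.
Proof.
rewrite (bigD1 (class_idx a))//= big1 ?addr0.
  congr (_ * _); apply: eq_bigr => i _.
  by rewrite /class_term ffunE eqxx mul1r.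
move=> k ka; suff -> : class_prod k a = 0 by rewrite mulr0.
have [i hi] : exists i, (a i %% l != k i)%N.
  apply/existsP; apply: contraNT ka; rewrite negb_exists => /forallP h.
  apply/eqP/ffunP => i; apply/val_inj; rewrite ffunE /=.
  by have := h i; rewrite negbK => /eqP.
by rewrite /class_prod (bigD1 i)//= /class_term (negbTE hi) !mul0r.
Qed.

Lemma cvg_periodic_sum : partial_sum periodic_term @ totally -->
  (\sum_k H k * \prod_i (cpow l%:R (- z i) * hurwitz_zeta (z i) ((k i).+1%:R / l%:R)) : Cplx R).
Proof.
have hk k : partial_sum (class_prod k) @ totally -->
  (\prod_i (cpow l%:R (- z i) * hurwitz_zeta (z i) ((k i).+1%:R / l%:R)) : Cplx R).
  apply: (@cvg_sum_prod R r (fun i => class_term (z i) (k i)) _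
    (fun i n => n.+1%:R `^ (- complex.Re (z i)))) => i.
  - by move=> n; exact: normc_class_term.
  - exact: cvg_series_powR.
  - exact: cvg_series_class_term.
have -> : partial_sum periodic_term =
  fun A => \sum_k (H k : R[i]) *: partial_sum (class_prod k) A.
  apply/funext => A; rewrite partial_sumE (eq_bigr _ (fun a _ => periodic_termE a)).
  rewrite exchange_big /=; apply: eq_bigr => k _.
  by rewrite partial_sumE /GRing.scale /= mulr_sumr.
elim: (index_enum _) => [|k s IH].
  rewrite big_nil (_ : (fun A => _) = cst 0); first exact: cvg_cst.
  by apply/funext => A; rewrite big_nil.
rewrite big_cons; set f := (fun A => _).
have -> : f = ((H k : R[i]) \*: partial_sum (class_prod k)) +
   (fun A => \sum_(k <- s) (H k : R[i]) *: partial_sum (class_prod k) A).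
  by apply/funext => A; rewrite /f big_cons.
exact: (@cvgD R[i] (Cplx R) _ totally _ _ _ _ _
  (@cvgZl_tmp R[i] (Cplx R) _ totally _ (H k) _ _ (hk k)) IH).
Qed.

(** Such a bound yields absolute convergence, [esum] being a supremum of finite sums. *)
Lemma periodic_sum_bounded : exists B : R, forall J : {fset {ffun 'I_r -> nat}},
  \sum_(a <- J) normc (periodic_term a) <= B.
Proof.
pose g (i : 'I_r) n : R := n.+1%:R `^ (- complex.Re (z i)).
pose P : R := \prod_i limn (series (g i)).
exists (\sum_k normc (H k) * P) => J.
apply: (@le_trans _ _ (\sum_(a <- J) \sum_k normc (H k) * \prod_i g i (a i))).
  apply: ler_sum => a _; rewrite periodic_termE.
  apply: le_trans (le_normc_sum _ _ _) _; apply: ler_sum => k _.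
  rewrite normcM ler_wpM2l ?normc_ge0// /class_prod normc_prod.
  by apply: ler_prod => i _; rewrite normc_ge0 normc_class_term.
rewrite exchange_big /=; apply: ler_sum => k _; rewrite -mulr_sumr.
rewrite ler_wpM2l ?normc_ge0//.
apply: (@sum_prod_le R r (fun i => class_term (z i) (k i)) g) => i.
  by move=> n; exact: normc_class_term.
exact: cvg_series_powR.
Qed.

End PointSum.

(** * The Igusa zeta function *)

Section IgusaPoint.
Variables (R : realType) (X : monoidal_space) (r : nat).
Variables (n : X -> nat) (Gam : X -> finGroupType).
Hypothesis unit_split : forall p : X, splits_as (units (stalk p)) (n p) (Gam p).
Implicit Types (s : 'rV[Cplx R]_r) (w : Cplx R).

Let l p := exponent [set: Gam p]%SET.

Let l0 p : (0 < l p)%N.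
Proof. exact: exponent_gt0. Qed.

Definition local_count w p (k : {ffun 'I_r -> 'I_(l p)}) : Cplx R :=
  cpow (num_hom (Gam p) (\prod_i (k i).+1)%N)%:R w.

(** With m the product of the m_i, the factor m^(n(p) w) distributes over the variables and shifts
    each s_i to s_i - n(p) w. The remaining torsion count depends only on the m_i modulo l(p). *)
Lemma igusa_termE s w p : igusa_term s w p =
  periodic_term (l0 p) (fun i => s 0 i - (n p)%:R * w) (@local_count w p).
Proof.
apply/funext => a; rewrite /igusa_term /periodic_term /local_count.
set m := (\prod_i (a i).+1)%N.
have m0 : (0 < m)%N by apply: prodn_gt0.
have -> : num_hom (units (stalk p)) m = (m ^ n p * num_hom (Gam p) m)%N.
  exact: num_hom_split.
have -> : num_hom (Gam p) (\prod_i (class_idx (l0 p) a i).+1)%N = num_hom (Gam p) m.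
  apply: (@num_hom_modn _ (l p)) => //; first exact: prodn_gt0.
  rewrite /m; elim/big_ind2: _ => // [x1 x2 y1 y2 e1 e2|i _].
    by rewrite -modnMm e1 e2 modnMm.
  by rewrite ffunE /= -addn1 modnDml addn1.
rewrite natrM cpowMl ?ltr0n ?expn_gt0 ?m0 ?num_hom_gt0//.
rewrite natrX cpowXl ?ltr0n// mulrC mulrA mulrC; congr (_ * _).
rewrite /m natr_prod cpow_prod; last by move=> i; rewrite ltr0n.
rewrite -big_split /=; apply: eq_bigr => i _.
by rewrite -cpowD opprB addrC.
Qed.

Lemma igusa_re_gt1 s w p : igusa_region n s w ->
  forall i, 1 < complex.Re (s 0 i - (n p)%:R * w).
Proof.
move=> h i; have := h i p; rewrite ReB.
have -> : complex.Re ((n p)%:R * w) = (n p)%:R * complex.Re w.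
  have -> : (n p)%:R = (n p)%:R%:C%C :> R[i] by rewrite rmorph_nat.
  by case: w {h} => a b /=; rewrite mul0r subr0.
by lra.
Qed.

Lemma igusa_abs_cvg_region s w : igusa_region n s w -> igusa_abs_cvg X s w.
Proof.
move=> h p; rewrite igusa_termE.
have [B hB] := periodic_sum_bounded (l0 p) (@local_count w p) (igusa_re_gt1 p h).
apply: (@le_lt_trans _ _ B%:E); last exact: ltry.
rewrite /esum; apply: ge_ereal_sup => _ [A [finA _] <-].
by rewrite fsbig_finite//= sumEFin lee_fin; exact: hB.
Qed.

Lemma igusa_zeta_region s w : igusa_region n s w ->
  igusa_zeta X s w = igusa_formula n Gam s w.
Proof.
move=> h; rewrite /igusa_zeta /igusa_formula.
apply: eq_fsbigr => p _; rewrite igusa_termE.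
have := @cvg_periodic_sum R r (l p) (l0 p) _ (@local_count w p) (igusa_re_gt1 p h).
by move=> hc; rewrite /summability.sum (cvg_limC _ hc).
Qed.

End IgusaPoint.

(** * Meromorphy of the explicit formula *)

Section IgusaMeromorphic.
Variables (R : realType) (r : nat).
Local Notation V := ('rV[Cplx R]_r * Cplx R)%type.

Lemma differentiable_sndC (z : V) : differentiable (fun z : V => z.2 : Cplx R) z.
Proof.
have @f : {linear V -> Cplx R}.
  by exists (fun z : V => z.2 : Cplx R); do 2![eexists]; do ?[constructor].
rewrite (_ : (fun _ => _) = f)//; apply: linear_differentiable.
by move=> u; exact: cvg_snd.
Qed.

Lemma meromorphic_snd (Z : Cplx R -> Cplx R) : meromorphic Z ->
  meromorphic (fun z : V => Z z.2).
Proof.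
apply: (@meromorphic_comp R V (fun z => z.2) (0, 1)) => [z|z t].
  exact: differentiable_sndC.
by rewrite /= /GRing.scale /= mulr1.
Qed.

Lemma meromorphic_shift (Z : Cplx R -> Cplx R) (i : 'I_r) (c : Cplx R) : meromorphic Z ->
  meromorphic (fun z : V => Z (z.1 0 i - c * z.2)).
Proof.
(* Along the unit vector of s_i, with w fixed, the form has slope 1. *)
apply: (@meromorphic_comp R V (fun z => z.1 0 i - c * z.2) (delta_mx 0 i, 0)) => [z|z t].
  have d1 : differentiable (fun z : V => z.1 0 i : Cplx R) z.
    apply: (@differentiable_comp R[i] V 'rV[Cplx R]_r (Cplx R) (fun z => z.1) (fun M => M 0 i)).
      have @f : {linear V -> 'rV[Cplx R]_r}.
        by exists (fun z : V => z.1); do 2![eexists]; do ?[constructor].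
      rewrite (_ : (fun _ => _) = f)//; apply: linear_differentiable.
      by move=> u; exact: cvg_fst.
    exact: (@differentiable_coord R[i] 1 r z.1 0 i).
  have d2 := differentiableMC (differentiable_cstC (- c) z) (differentiable_sndC z).
  apply: differentiable_extC (differentiableDC d1 d2) => u.
  by rewrite mulNr.
rewrite /= !mxE !eqxx scaler0 addr0 /GRing.scale /= mulr1.
by rewrite addrAC.
Qed.

Lemma meromorphic_igusa (X : monoidal_space) (n : X -> nat) (Gam : X -> finGroupType) :
  finite_set [set: X] ->
  meromorphic (fun z : V => igusa_formula n Gam z.1 z.2).
Proof.
move=> finX; rewrite /igusa_formula.
(* The index list of a finitely supported sum depends on where its terms are nonzero, hence on z;
   finiteness of X provides a fixed list. *)
rewrite [X in meromorphic X](_ : _ = (fun z : V => \sum_(p <- fset_set [set: X])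
  let l := exponent [set: Gam p]%SET in
    \sum_(k : {ffun 'I_r -> 'I_l})
      cpow (num_hom (Gam p) (\prod_i (k i).+1)%N)%:R z.2
      * \prod_i (cpow l%:R (- (z.1 0 i - (n p)%:R * z.2))
                 * hurwitz_zeta (z.1 0 i - (n p)%:R * z.2) ((k i).+1%:R / l%:R))));
  last by apply/funext => z; rewrite fsbig_finite.
apply: meromorphic_sum => p /=; apply: meromorphic_sum => k.
have l0 : (0 < exponent [set: Gam p]%SET)%N by exact: exponent_gt0.
apply: meromorphicM.
  apply: (@meromorphic_snd (cpow _)); apply: holomorphic_meromorphic.
  by apply: holomorphic_cpow; rewrite ltr0n num_hom_gt0// prodn_gt0.
apply: meromorphic_prod => i; apply: meromorphicM.
  apply: (@meromorphic_shift (fun s => cpow _ (- s))); apply: holomorphic_meromorphic.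
  by apply: holomorphic_cpowN; rewrite ltr0n.
apply: (@meromorphic_shift (fun s => hurwitz_zeta s _)).
have q0 : 0 < (k i).+1%:R / (exponent [set: Gam p]%SET)%:R :> R.
  by rewrite divr_gt0 ?ltr0n.
by have [_ _] := hurwitz_zetaP q0.
Qed.

End IgusaMeromorphic.

Theorem corollary0p2 (R : realType) (X : monoidal_space)
  (hX : noetherian_F1_scheme X) (r : nat) (hr : (1 <= r)%N)
  (n : X -> nat) (Gam : X -> finGroupType)
  (Gam_abelian : forall p : X, abelian [set: Gam p]%SET)
  (unit_split : forall p : X, splits_as (units (stalk p)) (n p) (Gam p)) :
  [/\ finite_set [set: X],
      (forall (s : 'rV[Cplx R]_r) (w : Cplx R), igusa_region n s w ->
         igusa_abs_cvg X s w /\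
         igusa_zeta X s w = igusa_formula n Gam s w) &
      meromorphic (fun z : 'rV[Cplx R]_r * Cplx R =>
         igusa_formula n Gam z.1 z.2)].
Proof.
have finX := finite_noetherian hX.
split=> [//|s w h|]; last exact: meromorphic_igusa.
by split; [exact: igusa_abs_cvg_region h|exact: igusa_zeta_region].
Qed.
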